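(* Let $R>0$, $P>0$ and $-1<a<1$, and let $$f(p,q)=\mathcal{C}\,\chi_{[0,R]}(|q|)\,\chi_{[0,P]}(|p|)\,\chi_{[-1,a]}(\cos\theta_{p,q}),$$ where $\mathcal{C}>0$ is the constant for which $\int f\,d\mu=1$. If $\mathcal{E}(f)=0$, then $$\mathcal{V}(f)>-\frac{9}{20}.$$
   Context: Points of $\mathbb{R}^6$ are written $(p,q)$ with momentum $p\in\mathbb{R}^3$ and position $q\in\mathbb{R}^3$; $\theta_{p,q}$ is the angle between the vectors $p$ and $q$ (defined for $p,q\ne0$); $\chi_I$ is the characteristic function of the interval $I$; $d\mu=d^3p\,d^3q$ is Lebesgue measure. Total energy: $$\mathcal{E}(f)=\int\sqrt{1+|p|^2}\,f(p,q)\,d\mu-\frac12\iint\frac{f(p',q')f(p,q)}{|q-q'|}\,d\mu\,d\mu'.$$ Virial: $\mathcal{V}(f)=\int (q\cdot p)\,f(p,q)\,d\mu$. *)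

(* Defs.v *)
From HB Require Import structures.
From mathcomp Require Import all_boot all_order all_algebra.
From mathcomp Require Import all_classical all_reals all_analysis.
Set Implicit Arguments.
Unset Strict Implicit.
Unset Printing Implicit Defensive.
Import Order.TTheory GRing.Theory Num.Theory.
Import numFieldNormedType.Exports.

Local Open Scope classical_set_scope.
Local Open Scope ring_scope.

(* The library proves that the product of two sigma-finite measures is
   sigma-finite, but inference on m1 \x m2 only finds its instance for
   subprobabilities, which blocks iterated products; hence this alias. *)
Section sigma_finite_product.
Local Open Scope ereal_scope.
Context d1 d2 (T1 : measurableType d1) (T2 : measurableType d2) (R : realType).
Variable m1 : {sigma_finite_measure set T1 -> \bar R}.
Variable m2 : {sigma_finite_measure set T2 -> \bar R}.

Definition sf_product : set (T1 * T2) -> \bar R := m1 \x m2.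

HB.instance Definition _ := Measure.on sf_product.

Let sf_product_sigma_finite : sigma_finite setT sf_product.
Proof.
have /sigma_finiteP[F [TF ndF Foo]] := sigma_finiteT m1.
have /sigma_finiteP[G [TG ndG Goo]] := sigma_finiteT m2.
exists (fun n => F n `*` G n).
  rewrite -setXTT TF TG predeqE => -[x y]; split.
    move=> [/= [n _ Fnx] [k _ Gky]]; exists (maxn n k) => //; split.
    - by move: x Fnx; exact/subsetPset/ndF/leq_maxl.
    - by move: y Gky; exact/subsetPset/ndG/leq_maxr.
  by move=> [n _ []/= ? ?]; split; exists n.
move=> k; have [? ?] := Foo k; have [? ?] := Goo k.
split; first exact: measurableX.
by rewrite /sf_product product_measure1E// lte_mul_pinfty// ge0_fin_numE.
Qed.

HB.instance Definition _ := Measure_isSigmaFinite.Build _ _ _ sf_product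
  sf_product_sigma_finite.

End sigma_finite_product.

(* A point z of phase space is (p, q): z.1 is the momentum, z.2 the position.
   measurableTypeR R is R with the Borel sigma-algebra carried by
   lebesgue_measure. *)
Notation vec3 R :=
  (measurableTypeR R * measurableTypeR R * measurableTypeR R)%type.
Notation phase R := (vec3 R * vec3 R)%type.

Definition leb3 (R : realType) : {sigma_finite_measure set (vec3 R) -> \bar R} :=
  sf_product (sf_product (@lebesgue_measure R) (@lebesgue_measure R))
    (@lebesgue_measure R).

Definition leb6 (R : realType) : {sigma_finite_measure set (phase R) -> \bar R} :=
  sf_product (leb3 R) (leb3 R).

Definition dot3 {R : realType} (x y : vec3 R) : R :=
  x.1.1 * y.1.1 + x.1.2 * y.1.2 + x.2 * y.2.

(* The library norm of a product type is the max norm, hence this definition. *)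
Definition norm3 {R : realType} (x : vec3 R) : R := Num.sqrt (dot3 x x).

(* When x or y is zero, the quotient is 0 and the angle is pi / 2. *)
Definition angle {R : realType} (x y : vec3 R) : R :=
  acos (dot3 x y / (norm3 x * norm3 y)).

(* On the null set q = q', the factor 1 / |q - q'| is 1 / 0 = 0. *)
Definition energy {R : realType} (f : phase R -> R) : \bar R :=
  (\int[leb6 R]_z (Num.sqrt (1 + norm3 z.1 ^+ 2) * f z)%:E
   - (2^-1)%:E * \int[leb6 R \x leb6 R]_w
       (f w.2 * f w.1 / norm3 (w.1.2 - w.2.2))%:E)%E.

Definition mass {R : realType} (f : phase R -> R) : \bar R :=
  (\int[leb6 R]_z (f z)%:E)%E.

Definition virial {R : realType} (f : phase R -> R) : \bar R :=
  (\int[leb6 R]_z (dot3 z.2 z.1 * f z)%:E)%E.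

Definition cone_density {R : realType} (r P a C : R) (z : phase R) : R :=
  C * \1_(`[0, r]) (norm3 z.2) * \1_(`[0, P]) (norm3 z.1)
    * \1_(`[-1, a]) (cos (angle z.1 z.2)).

(* Main.v *)
Require Import Defs.
From HB Require Import structures.
From mathcomp Require Import all_boot all_order all_algebra.
From mathcomp Require Import all_classical all_reals all_analysis.
From mathcomp Require Import measurable_realfun ring lra.
Set Implicit Arguments.
Unset Strict Implicit.
Unset Printing Implicit Defensive.
Import Order.TTheory GRing.Theory Num.Theory.
Import numFieldNormedType.Exports.

(* The spatial marginal of f is uniform on the ball of radius r, because by
   rotation invariance the momenta making an angle with cosine at most a with
   a given q <> 0 have a volume that does not depend on q.  The potential
   energy is therefore that of a uniform ball, 3/(5r).  The average of |p| is
   3P/4, so the kinetic energy exceeds 3P/4 by some delta > 0, and zero total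
   energy forces r P < 4/5.  Finally q.p >= -|q||p|, and the average of |q||p|
   is (9/16) r P < 9/20.

   No polar coordinates are needed: a planar rotation is a product of three
   shears, which preserve Lebesgue measure by Fubini and translation
   invariance, and radial integrals follow from a layer-cake formula and the
   scaling of volumes. *)

Local Open Scope classical_set_scope.
Local Open Scope ring_scope.

(** Under f the variables |p| and |q| are independent, because for every q other than 0 the angular
    cut keeps the same share of each sphere of momenta. Each of them averages to 3/4 of its radius,
    whence 9/16 = (3/4)^2. One-sided bounds are enough: the potential energy enters with a minus
    sign and needs only an upper bound, while the kinetic energy needs only a lower one. The area of
    the unit disk, the volume of the unit cone and C are never evaluated. Each phase-space integral
    is a multiple of a power of the mass, and mass 1 removes all three together. Two degenerate
    configurations need separate care. At q = 0 the angle is a convention and the cut is no longer a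
    cone, so slices over q are compared only almost everywhere. The factorisation into shears uses
    the tangent of half the angle, which a half turn does not have. Strictness is secured by a
    uniform gap between sqrt(1 + |p|^2) and |p| on the support: integrated against mass 1 it
    survives as a number, whereas a pointwise strict inequality would need an extra argument about
    null sets. *)

Section measurability.
Context d (T : measurableType d) (R : realType).

Lemma measurable_sqrt (f : T -> R) :
  measurable_fun setT f -> measurable_fun setT (fun x => Num.sqrt (f x)).
Proof.
move=> mf; apply: (measurableT_comp (f := @Num.sqrt R)) => //.
by apply: continuous_measurable_fun => x; exact: sqrt_continuous.
Qed.

Lemma measurable_invr (f : T -> R) :
  measurable_fun setT f -> measurable_fun setT (fun x => (f x)^-1).
Proof.
move=> mf.
(* The real power with exponent -1 is the inverse only on nonnegative bases, hence the square; where
   [f x] vanishes both sides are 0. *)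
rewrite (_ : (fun _ => _) = fun x => f x * (f x ^+ 2) `^ (- 1)); last first.
  apply/funext => x; rewrite powR_inv1 ?sqr_ge0//.
  have [->|f0] := eqVneq (f x) 0; first by rewrite invr0 mul0r.
  by rewrite expr2 invfM mulrA divff// mul1r.
apply: measurable_funM => //.
apply: (measurableT_comp (f := @powR R ^~ (- 1))) => //.
exact: measurable_funX.
Qed.

Lemma measurable_natb (b : T -> bool) :
  measurable_fun setT b -> measurable_fun setT (fun x => (b x)%:R : R).
Proof.
move=> mb; rewrite (_ : (fun _ => _) = fun x => if b x then 1 else 0).
  exact: measurable_fun_ifT.
by apply/funext => x; case: (b x).
Qed.

End measurability.

Section product_integrals.
Local Open Scope ereal_scope.
Context d1 d2 (T1 : measurableType d1) (T2 : measurableType d2) (R : realType).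
Variable m1 : {sigma_finite_measure set T1 -> \bar R}.
Variable m2 : {sigma_finite_measure set T2 -> \bar R}.
Variable f : T1 * T2 -> \bar R.
Hypotheses (mf : measurable_fun setT f) (f0 : forall z, 0 <= f z).

Lemma sf_product_integral1 :
  \int[sf_product m1 m2]_z f z = \int[m1]_x \int[m2]_y f (x, y).
Proof. exact: fubini_tonelli1. Qed.

Lemma sf_product_integral2 :
  \int[sf_product m1 m2]_z f z = \int[m2]_y \int[m1]_x f (x, y).
Proof. exact: fubini_tonelli2. Qed.

End product_integrals.

(** * Translations, dilations and shears under Lebesgue measure *)

Section affine_line.
Local Open Scope ereal_scope.
Context (R : realType).
Notation mu := (@lebesgue_measure R).

(** Lebesgue measure is determined by its values on half-open intervals, so comparing the lengths of
    their preimages identifies it with [k] times its pushforward by [phi]. *)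
Lemma integral_ocitv_pushforward (phi : measurableTypeR R -> measurableTypeR R)
    (k : {nonneg R}) (f : measurableTypeR R -> \bar R) :
  measurable_fun setT phi ->
  (forall X, ocitv X -> mu X = k%:num%:E * mu (phi @^-1` X)) ->
  measurable_fun setT f -> (forall x, 0 <= f x) ->
  \int[mu]_x f x = k%:num%:E * \int[mu]_x f (phi x).
Proof.
move=> mphi phiE mf f0.
pose nu : {measure set (measurableTypeR R) -> \bar R} :=
  measure_function_pushforward__canonical__measure_function_Measure mu mphi.
have -> : \int[mu]_x f (phi x) = \int[nu]_x f x.
  by rewrite (ge0_integral_pushforward mphi mu).
rewrite -(ge0_integral_mscale nu measurableT) //.
apply: eq_measure_integral => A mA _.
exact: lebesgue_measure_unique.
Qed.

Lemma integral_translation (a : R) (f : measurableTypeR R -> \bar R) :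
  measurable_fun setT f -> (forall x, 0 <= f x) ->
  \int[mu]_x f (x + a)%R = \int[mu]_x f x.
Proof.
move=> mf f0; rewrite [RHS](@integral_ocitv_pushforward
  (fun x => x + a)%R (NngNum ler01))//=.
- by rewrite mul1e.
- exact: measurable_funD.
move=> _ [[u v]] _ <-.
rewrite (_ : _ @^-1` _ = `]u - a, v - a]%classic)%R; last first.
  by apply/seteqP; split => x /=; rewrite !in_itv/= ltrBlDr lerBrDr.
rewrite mul1e !lebesgue_measure_itv/= !lte_fin ltrD2r.
by case: ifP => // _; rewrite -!EFinD; congr EFin; ring.
Qed.

Lemma integral_dilation (a : R) (f : measurableTypeR R -> \bar R) :
  (0 < a)%R -> measurable_fun setT f -> (forall x, 0 <= f x) ->
  \int[mu]_x f x = a%:E * \int[mu]_x f (a * x)%R.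
Proof.
move=> a0 mf f0.
rewrite [LHS](@integral_ocitv_pushforward ( *%R a) (NngNum (ltW a0)))//.
move=> _ [[u v]] _ <-.
rewrite (_ : _ @^-1` _ = `]u / a, v / a]%classic)%R; last first.
  by apply/seteqP; split => x /=;
    rewrite !in_itv/= ltr_pdivrMr// ler_pdivlMr// mulrC.
rewrite !lebesgue_measure_itv/= !lte_fin ltr_pM2r ?invr_gt0//.
case: ifP => _; rewrite ?mule0// -!EFinD -EFinM.
by congr EFin; field; rewrite gt_eqF.
Qed.

End affine_line.

Section shears.
Local Open Scope ereal_scope.
Context d (T : measurableType d) (R : realType).
Notation mu := (@lebesgue_measure R).
Variables (m : {sigma_finite_measure set T -> \bar R}) (phi : T -> R).
Hypothesis mphi : measurable_fun setT phi.

Lemma integral_shear2 (f : T * measurableTypeR R -> \bar R) :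
  measurable_fun setT f -> (forall z, 0 <= f z) ->
  \int[sf_product m mu]_z f (z.1, z.2 + phi z.1)%R =
  \int[sf_product m mu]_z f z.
Proof.
move=> mf f0.
have mg : measurable_fun setT (fun z : T * measurableTypeR R =>
    f (z.1, z.2 + phi z.1)%R).
  apply: measurableT_comp => //; apply: measurable_fun_pair => //=.
  by apply: measurable_funD => //; exact: measurableT_comp.
rewrite (sf_product_integral1 _ _ mf f0).
rewrite (sf_product_integral1 _ _ mg (fun=> f0 _)).
apply: eq_integral => x _ /=.
rewrite (integral_translation _ (f := fun y => f (x, y)))//.
exact: measurableT_comp.
Qed.

Lemma integral_shear1 (f : measurableTypeR R * T -> \bar R) :
  measurable_fun setT f -> (forall z, 0 <= f z) ->
  \int[sf_product mu m]_z f (z.1 + phi z.2, z.2)%R =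
  \int[sf_product mu m]_z f z.
Proof.
move=> mf f0.
have mg : measurable_fun setT (fun z : measurableTypeR R * T =>
    f (z.1 + phi z.2, z.2)%R).
  apply: measurableT_comp => //; apply: measurable_fun_pair => //=.
  by apply: measurable_funD => //; exact: measurableT_comp.
rewrite (sf_product_integral2 _ _ mf f0).
rewrite (sf_product_integral2 _ _ mg (fun=> f0 _)).
apply: eq_integral => y _ /=.
rewrite (integral_translation _ (f := fun x => f (x, y)))//.
exact: measurableT_comp.
Qed.

End shears.

Section vec3_functions.
Context (R : realType).

Lemma measurable_vec3 d (T : measurableType d)
    (f g h : T -> measurableTypeR R) :
  measurable_fun setT f -> measurable_fun setT g -> measurable_fun setT h ->
  measurable_fun setT (fun x => (f x, g x, h x) : vec3 R).
Proof.
by move=> mf mg mh; do 2 apply: measurable_fun_pair => //.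
Qed.

Lemma measurable_vec3_1 : measurable_fun setT (fun x : vec3 R => x.1.1).
Proof. exact: measurableT_comp. Qed.

Lemma measurable_vec3_2 : measurable_fun setT (fun x : vec3 R => x.1.2).
Proof. exact: measurableT_comp. Qed.

Lemma measurable_vec3_3 : measurable_fun setT (fun x : vec3 R => x.2).
Proof. exact: measurable_snd. Qed.

End vec3_functions.

Definition leb2 (R : realType) :
    {sigma_finite_measure
      set (measurableTypeR R * measurableTypeR R)%type -> \bar R} :=
  sf_product (@lebesgue_measure R) (@lebesgue_measure R).

Section leb3_fubini.
Local Open Scope ereal_scope.
Context (R : realType) (f : vec3 R -> \bar R).
Hypotheses (mf : measurable_fun setT f) (f0 : forall x, 0 <= f x).

Lemma integral_leb3 :
  \int[leb3 R]_x f x =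
  \int[@lebesgue_measure R]_z \int[leb2 R]_x f (x, z).
Proof. exact: sf_product_integral2. Qed.

Lemma measurable_integral_leb2 :
  measurable_fun setT (fun z => \int[leb2 R]_x f (x, z)).
Proof. exact: (measurable_fun_fubini_tonelli_G (m1 := leb2 R) f). Qed.

End leb3_fubini.

Section elementary_shears.
Local Open Scope ereal_scope.
Context (R : realType).
Variables (t : R) (f : vec3 R -> \bar R).
Hypotheses (mf : measurable_fun setT f) (f0 : forall x, 0 <= f x).

Let mf_slice z : measurable_fun setT (fun x => f (x, z)).
Proof. exact: measurableT_comp. Qed.

Let measurable_comb (g h : vec3 R -> R) :
  measurable_fun setT g -> measurable_fun setT h ->
  measurable_fun setT (fun x => g x + t * h x)%R.
Proof. by move=> mg mh; apply: measurable_funD => //; exact: measurable_funM. Qed.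

Lemma integral_shear12 :
  \int[leb3 R]_x f (x.1.1 + t * x.1.2, x.1.2, x.2)%R = \int[leb3 R]_x f x.
Proof.
have mg : measurable_fun setT (fun x : vec3 R =>
    f (x.1.1 + t * x.1.2, x.1.2, x.2)%R).
  apply: measurableT_comp => //; apply: measurable_vec3;
    [apply: measurable_comb| |]; by [exact: measurable_vec3_1|
    exact: measurable_vec3_2|exact: measurable_vec3_3].
rewrite (integral_leb3 mf f0) (integral_leb3 mg (fun=> f0 _)).
apply: eq_integral => z _ /=.
apply: (@integral_shear1 _ (measurableTypeR R) _ _ (fun y => t * y)%R _
  (fun x => f (x, z))) => //.
exact: measurable_funM.
Qed.

Lemma integral_shear21 :
  \int[leb3 R]_x f (x.1.1, x.1.2 + t * x.1.1, x.2)%R = \int[leb3 R]_x f x.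
Proof.
have mg : measurable_fun setT (fun x : vec3 R =>
    f (x.1.1, x.1.2 + t * x.1.1, x.2)%R).
  apply: measurableT_comp => //; apply: measurable_vec3;
    [|apply: measurable_comb|]; by [exact: measurable_vec3_1|
    exact: measurable_vec3_2|exact: measurable_vec3_3].
rewrite (integral_leb3 mf f0) (integral_leb3 mg (fun=> f0 _)).
apply: eq_integral => z _ /=.
apply: (@integral_shear2 _ (measurableTypeR R) _ _ (fun y => t * y)%R _
  (fun x => f (x, z))) => //.
exact: measurable_funM.
Qed.

Lemma integral_shear23 :
  \int[leb3 R]_x f (x.1.1, x.1.2 + t * x.2, x.2)%R = \int[leb3 R]_x f x.
Proof.
have mg : measurable_fun setT (fun x : vec3 R =>
    f (x.1.1, x.1.2 + t * x.2, x.2)%R).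
  apply: measurableT_comp => //; apply: measurable_vec3;
    [|apply: measurable_comb|]; by [exact: measurable_vec3_1|
    exact: measurable_vec3_2|exact: measurable_vec3_3].
rewrite (integral_leb3 mf f0) (integral_leb3 mg (fun=> f0 _)).
apply: eq_integral => z _ /=.
exact: (@integral_shear2 _ (measurableTypeR R) _ _ (cst (t * z))%R _
  (fun x => f (x, z))).
Qed.

Lemma integral_shear32 :
  \int[leb3 R]_x f (x.1.1, x.1.2, x.2 + t * x.1.2)%R = \int[leb3 R]_x f x.
Proof.
transitivity (\int[leb3 R]_x f (x.1, x.2 + t * x.1.2)%R).
  by apply: eq_integral => -[[x y] z].
(* The outermost coordinate moves here, so the shear is taken on plane times line, without slicing
   by height. *)
apply: (@integral_shear2 _ (measurableTypeR R * measurableTypeR R)%type _ _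
  (fun x => t * x.2)%R) => //.
exact: measurable_funM.
Qed.

End elementary_shears.

Section scaling.
Local Open Scope ereal_scope.
Context (R : realType).

Lemma integral_dilation2 (a : R)
    (f : measurableTypeR R * measurableTypeR R -> \bar R) :
  (0 < a)%R -> measurable_fun setT f -> (forall x, 0 <= f x) ->
  \int[leb2 R]_x f x = (a ^+ 2)%:E * \int[leb2 R]_x f (a * x.1, a * x.2)%R.
Proof.
move=> a0 mf f0.
have mg : measurable_fun setT (fun x : measurableTypeR R * measurableTypeR R =>
    f (a * x.1, a * x.2)%R).
  by apply: measurableT_comp => //; apply: measurable_fun_pair => //=;
    exact: measurable_funM.
rewrite /leb2 (sf_product_integral1 _ _ mf f0).
rewrite (sf_product_integral1 _ _ mg (fun=> f0 _))/=.
rewrite (integral_dilation a0); last 2 first.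
- exact: (measurable_fun_fubini_tonelli_F f).
- by move=> x; exact: integral_ge0.
rewrite expr2 EFinM -muleA; congr (_ * _).
rewrite -ge0_integralZl//; last 3 first.
- exact: (measurable_fun_fubini_tonelli_F _ mg).
- by move=> x _; exact: integral_ge0.
- by rewrite lee_fin ltW.
apply: eq_integral => x _.
by rewrite (integral_dilation a0)//; exact: measurableT_comp.
Qed.

Lemma integral_dilation3 (a : R) (f : vec3 R -> \bar R) :
  (0 < a)%R -> measurable_fun setT f -> (forall x, 0 <= f x) ->
  \int[leb3 R]_x f x =
  (a ^+ 3)%:E * \int[leb3 R]_x f (a * x.1.1, a * x.1.2, a * x.2)%R.
Proof.
move=> a0 mf f0.
have mg : measurable_fun setT (fun x : vec3 R =>
    f (a * x.1.1, a * x.1.2, a * x.2)%R).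
  apply: measurableT_comp => //.
  by apply: measurable_vec3; apply: measurable_funM => //;
    by [exact: measurable_vec3_1|
    exact: measurable_vec3_2|exact: measurable_vec3_3].
rewrite (integral_leb3 mf f0) (integral_leb3 mg (fun=> f0 _)).
rewrite (integral_dilation a0); last 2 first.
- exact: measurable_integral_leb2.
- by move=> x; exact: integral_ge0.
rewrite exprS EFinM -muleA; congr (_ * _).
rewrite -ge0_integralZl//; last 3 first.
- exact: (measurable_integral_leb2 mg).
- by move=> x _; exact: integral_ge0.
- by rewrite lee_fin exprn_ge0// ltW.
apply: eq_integral => z _.
by rewrite (integral_dilation2 a0)//; exact: measurableT_comp.
Qed.

End scaling.

(** * Rotations and rotation-invariant integrals *)

Section rotations.
Local Open Scope ereal_scope.
Context (R : realType) (c s : R).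
Hypotheses (cs1 : (c ^+ 2 + s ^+ 2 = 1)%R) (cN1 : (1 + c != 0)%R).
Variable f : vec3 R -> \bar R.
Hypotheses (mf : measurable_fun setT f) (f0 : forall x, 0 <= f x).

(* The tangent of half the angle: the rotation is the product of the shears
   with parameters -t, s and -t along alternating axes. *)
Let t := (s / (1 + c))%R.

Let shear_shearE (x y : R) :
  ((x - t * y) - t * (y + s * (x - t * y)) = c * x - s * y)%R /\
  (y + s * (x - t * y) = s * x + c * y)%R.
Proof.
(* The product of the three shear matrices reduces to two half-angle identities: this one and
   [t * (1 + c) = s]. *)
have st : (s * t = 1 - c)%R.
  transitivity (s ^+ 2 / (1 + c))%R; first by rewrite /t mulrA.
  have -> : (s ^+ 2 = 1 - c ^+ 2)%R by rewrite -cs1; ring.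
  by field.
have tc : (t * (1 + c) = s)%R by rewrite /t divfK.
have E : (y + s * (x - t * y) = s * x + c * y)%R.
  by transitivity (s * x + (1 - s * t) * y)%R; [ring|rewrite st; ring].
split => //; rewrite E; transitivity ((1 - s * t) * x - (t * (1 + c)) * y)%R.
  by ring.
by rewrite st tc; ring.
Qed.

Lemma integral_rotation12 :
  \int[leb3 R]_x f (c * x.1.1 - s * x.1.2, s * x.1.1 + c * x.1.2, x.2)%R =
  \int[leb3 R]_x f x.
Proof.
have m1 : measurable_fun setT
    (fun x : vec3 R => f (x.1.1 + (- t) * x.1.2, x.1.2, x.2)%R).
  apply: measurableT_comp => //; apply: measurable_vec3;
    [apply: measurable_funD => //; last apply: measurable_funM => //| |];
    by [exact: measurable_vec3_1|exact: measurable_vec3_2|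
        exact: measurable_vec3_3].
have m2 : measurable_fun setT (fun x : vec3 R =>
    f (x.1.1 + (- t) * (x.1.2 + s * x.1.1), x.1.2 + s * x.1.1, x.2)%R).
  pose h (x : vec3 R) : vec3 R := (x.1.1, x.1.2 + s * x.1.1, x.2)%R.
  apply: (measurableT_comp (g := h) m1); apply: measurable_vec3;
    [|apply: measurable_funD => //; last apply: measurable_funM => //|];
    by [exact: measurable_vec3_1|exact: measurable_vec3_2|
        exact: measurable_vec3_3].
rewrite -(integral_shear12 (- t) mf f0) -(integral_shear21 s m1 (fun=> f0 _)).
rewrite -(integral_shear12 (- t) m2 (fun=> f0 _)).
apply: eq_integral => -[[x y] z] _ /=.
by have [<- <-] := shear_shearE x y; rewrite !mulNr.
Qed.

Lemma integral_rotation23 :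
  \int[leb3 R]_x f (x.1.1, c * x.1.2 - s * x.2, s * x.1.2 + c * x.2)%R =
  \int[leb3 R]_x f x.
Proof.
have m1 : measurable_fun setT
    (fun x : vec3 R => f (x.1.1, x.1.2 + (- t) * x.2, x.2)%R).
  apply: measurableT_comp => //; apply: measurable_vec3;
    [|apply: measurable_funD => //; last apply: measurable_funM => //|];
    by [exact: measurable_vec3_1|exact: measurable_vec3_2|
        exact: measurable_vec3_3].
have m2 : measurable_fun setT (fun x : vec3 R =>
    f (x.1.1, x.1.2 + (- t) * (x.2 + s * x.1.2), x.2 + s * x.1.2)%R).
  pose h (x : vec3 R) : vec3 R := (x.1.1, x.1.2, x.2 + s * x.1.2)%R.
  apply: (measurableT_comp (g := h) m1); apply: measurable_vec3;
    [| |apply: measurable_funD => //; last apply: measurable_funM => //];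
    by [exact: measurable_vec3_1|exact: measurable_vec3_2|
        exact: measurable_vec3_3].
rewrite -(integral_shear23 (- t) mf f0) -(integral_shear32 s m1 (fun=> f0 _)).
rewrite -(integral_shear23 (- t) m2 (fun=> f0 _)).
apply: eq_integral => -[[x y] z] _ /=.
by have [<- <-] := shear_shearE y z; rewrite !mulNr.
Qed.

End rotations.

Section isotropy.
Context (R : realType).
Implicit Types x y u : vec3 R.

Lemma dot3C x y : dot3 x y = dot3 y x.
Proof. by rewrite /dot3; ring. Qed.

Lemma dot3_ge0 x : 0 <= dot3 x x.
Proof. by rewrite /dot3 -!expr2 !addr_ge0// sqr_ge0. Qed.

Lemma norm3_ge0 x : 0 <= norm3 x.
Proof. exact: sqrtr_ge0. Qed.

Lemma sqr_norm3 x : norm3 x ^+ 2 = dot3 x x.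
Proof. by rewrite sqr_sqrtr// dot3_ge0. Qed.

Lemma measurable_dot3 d (T : measurableType d) (f g : T -> vec3 R) :
  measurable_fun setT f -> measurable_fun setT g ->
  measurable_fun setT (fun t => dot3 (f t) (g t)).
Proof.
move=> mf mg; apply: measurable_funD; first apply: measurable_funD.
- by apply: measurable_funM; apply: (measurableT_comp (@measurable_vec3_1 R)).
- by apply: measurable_funM; apply: (measurableT_comp (@measurable_vec3_2 R)).
- by apply: measurable_funM; apply: (measurableT_comp (@measurable_vec3_3 R)).
Qed.

Lemma measurable_norm3 d (T : measurableType d) (f : T -> vec3 R) :
  measurable_fun setT f -> measurable_fun setT (fun t => norm3 (f t)).
Proof. by move=> mf; apply: measurable_sqrt; exact: measurable_dot3. Qed.

Lemma dot3_rotation12 (c s : R) x y : c ^+ 2 + s ^+ 2 = 1 ->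
  dot3 (c * x.1.1 - s * x.1.2, s * x.1.1 + c * x.1.2, x.2)
       (c * y.1.1 - s * y.1.2, s * y.1.1 + c * y.1.2, y.2) = dot3 x y.
Proof.
move=> cs1; rewrite /dot3/=.
transitivity ((c ^+ 2 + s ^+ 2) * (x.1.1 * y.1.1 + x.1.2 * y.1.2) + x.2 * y.2).
  by ring.
by rewrite cs1; ring.
Qed.

Lemma dot3_rotation23 (c s : R) x y : c ^+ 2 + s ^+ 2 = 1 ->
  dot3 (x.1.1, c * x.1.2 - s * x.2, s * x.1.2 + c * x.2)
       (y.1.1, c * y.1.2 - s * y.2, s * y.1.2 + c * y.2) = dot3 x y.
Proof.
move=> cs1; rewrite /dot3/=.
transitivity (x.1.1 * y.1.1 + (c ^+ 2 + s ^+ 2) * (x.1.2 * y.1.2 + x.2 * y.2)).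
  by ring.
by rewrite cs1; ring.
Qed.

Variable G : R -> R -> R.
Hypothesis mG : measurable_fun setT
  (fun z : measurableTypeR R * measurableTypeR R => G z.1 z.2).
Hypothesis G0 : forall a b, 0 <= G a b.

(** Norm and dot product are what a simultaneous rotation of [x] and [u] preserves. This form covers
    both the cone indicator and the kernel 1 / |u - x|. *)
Definition zonal u := (\int[leb3 R]_x (G (norm3 x) (dot3 x u))%:E)%E.

Lemma measurable_zonal u :
  measurable_fun setT (fun x => (G (norm3 x) (dot3 x u))%:E).
Proof.
apply/measurable_EFinP.
apply: (measurableT_comp (g := fun x =>
  (norm3 x, dot3 x u) : measurableTypeR R * measurableTypeR R) mG).
by apply: measurable_fun_pair; [exact: measurable_norm3|exact: measurable_dot3].
Qed.

Lemma eq_zonal a b c a' b' c' :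
  a = a' -> b = b' -> c = c' -> zonal (a, b, c) = zonal (a', b', c').
Proof. by move=> -> -> ->. Qed.

(** Rotating [u] is compensated by the same rotation of the integration variable, which preserves
    both the measure and the integrand. *)
Lemma zonal_rotation12 (c s : R) u : c ^+ 2 + s ^+ 2 = 1 ->
  zonal u = zonal (c * u.1.1 - s * u.1.2, s * u.1.1 + c * u.1.2, u.2).
Proof.
have gen (d e : R) v : d ^+ 2 + e ^+ 2 = 1 -> 1 + d != 0 ->
    zonal v = zonal (d * v.1.1 - e * v.1.2, e * v.1.1 + d * v.1.2, v.2).
  move=> de1 d0; rewrite /zonal -[RHS](integral_rotation12 de1 d0); last 2 first.
  - exact: measurable_zonal.
  - by move=> x; rewrite lee_fin.
  by apply: eq_integral => x _; rewrite /norm3 !(dot3_rotation12 _ _ de1).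
move=> cs1; have [c1|c1] := eqVneq (1 + c) 0; last exact: gen.
have cN1 : c = -1 by lra.
have s0 : s = 0.
  by apply/eqP; rewrite -sqrf_eq0; apply/eqP; move: cs1; rewrite cN1; lra.
(* The half turn, excluded from [gen], is the square of a quarter turn. *)
rewrite (@gen 0 1) ?expr0n ?expr1n/= ?add0r ?addr0 ?oner_eq0//.
rewrite (@gen 0 1) ?expr0n ?expr1n/= ?add0r ?addr0 ?oner_eq0//=.
by apply: eq_zonal; rewrite ?s0 ?cN1; ring.
Qed.

Lemma zonal_rotation23 (c s : R) u : c ^+ 2 + s ^+ 2 = 1 ->
  zonal u = zonal (u.1.1, c * u.1.2 - s * u.2, s * u.1.2 + c * u.2).
Proof.
have gen (d e : R) v : d ^+ 2 + e ^+ 2 = 1 -> 1 + d != 0 ->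
    zonal v = zonal (v.1.1, d * v.1.2 - e * v.2, e * v.1.2 + d * v.2).
  move=> de1 d0; rewrite /zonal -[RHS](integral_rotation23 de1 d0); last 2 first.
  - exact: measurable_zonal.
  - by move=> x; rewrite lee_fin.
  by apply: eq_integral => x _; rewrite /norm3 !(dot3_rotation23 _ _ de1).
move=> cs1; have [c1|c1] := eqVneq (1 + c) 0; last exact: gen.
have cN1 : c = -1 by lra.
have s0 : s = 0.
  by apply/eqP; rewrite -sqrf_eq0; apply/eqP; move: cs1; rewrite cN1; lra.
rewrite (@gen 0 1) ?expr0n ?expr1n/= ?add0r ?addr0 ?oner_eq0//.
rewrite (@gen 0 1) ?expr0n ?expr1n/= ?add0r ?addr0 ?oner_eq0//=.
by apply: eq_zonal; rewrite ?s0 ?cN1; ring.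
Qed.

(** A rotation of the first two coordinates annihilates the first one, then a rotation of the last
    two annihilates the second. The radii [p] and [n] divide the sines and cosines, so their
    vanishing is treated apart. *)
Lemma zonal_pole u : zonal u = zonal (0, 0, norm3 u).
Proof.
case: u => -[u1 u2] u3.
pose p := Num.sqrt (u1 ^+ 2 + u2 ^+ 2).
have p2 : p ^+ 2 = u1 ^+ 2 + u2 ^+ 2 by rewrite sqr_sqrtr// addr_ge0// sqr_ge0.
pose n := norm3 (u1, u2, u3).
have n2 : n ^+ 2 = p ^+ 2 + u3 ^+ 2 by rewrite sqr_norm3 p2 /dot3/=; ring.
transitivity (zonal (0, p, u3)).
  have [p0|p0] := eqVneq p 0.
    have [u10 u20] : u1 = 0 /\ u2 = 0.
      move/esym/eqP: p2; rewrite p0 expr0n/= paddr_eq0 ?sqr_ge0// !sqrf_eq0.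
      by move=> /andP[/eqP -> /eqP ->].
    by rewrite p0 u10 u20.
  rewrite (@zonal_rotation12 (u2 / p) (u1 / p))/=.
    apply: eq_zonal => //; first by field.
    transitivity ((u1 ^+ 2 + u2 ^+ 2) / p); first by field.
    by rewrite -p2; field.
  transitivity ((u1 ^+ 2 + u2 ^+ 2) / p ^+ 2); first by field.
  by rewrite -p2; field.
rewrite -/n; have [n0|n0] := eqVneq n 0.
  have [p0 u30] : p = 0 /\ u3 = 0.
    move/esym/eqP: n2; rewrite n0 expr0n/= paddr_eq0 ?sqr_ge0// !sqrf_eq0.
    by move=> /andP[/eqP -> /eqP ->].
  by rewrite p0 u30 n0.
rewrite (@zonal_rotation23 (u3 / n) (p / n))/=.
  apply: eq_zonal => //; first by field.
  transitivity ((p ^+ 2 + u3 ^+ 2) / n); first by field.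
  by rewrite -n2; field.
transitivity ((p ^+ 2 + u3 ^+ 2) / n ^+ 2); first by field.
by rewrite -n2; field.
Qed.

End isotropy.

(** * Integrals on an interval, layer cake and radial moments *)

Section line_integrals.
Local Open Scope ereal_scope.
Context (R : realType).
Notation mu := (@lebesgue_measure R).
Implicit Types (f F : R -> R) (a b : R).

(** Differentiability is asked only inside the interval because the primitive used for the surface
    potential contains a square root that vanishes at the right end. *)
Lemma integral_is_derive f F a b : (a <= b)%R ->
  {in `[a, b]%R, continuous f} -> {in `[a, b]%R, continuous F} ->
  (forall x : R, x \in `]a, b[%R -> is_derive x (1 : R)%R F (f x)) ->
  \int[mu]_(x in `[a, b]) (f x)%:E = (F b - F a)%:E.
Proof.
move=> ab cf cF dF; move: ab; rewrite le_eqVlt => /predU1P[<-|ab].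
  by rewrite set_itv1 integral_set1 subrr.
rewrite (@continuous_FTC2 _ f F a b)//.
- by apply: continuous_in_subspaceT => x /set_mem; exact: cf.
- split; first by move=> x /dF [].
    by apply: cvg_at_right_filter; apply: cF; rewrite in_itv/= lexx ltW.
  by apply: cvg_at_left_filter; apply: cF; rewrite in_itv/= lexx ltW.
- by move=> x /dF []; rewrite derive1E.
Qed.

Lemma integral_itv_natb f a b :
  \int[mu]_x ((a <= x <= b)%R%:R * f x)%:E = \int[mu]_(x in `[a, b]) (f x)%:E.
Proof.
rewrite [RHS]integral_mkcond; apply: eq_integral => x _; rewrite patchE.
case: ifPn; rewrite (inE, notin_setE)/= in_itv/=.
  by move=> ->; rewrite mul1r.
by move=> /negP/negbTE ->; rewrite mul0r.
Qed.

End line_integrals.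

Section layer_cake.
Local Open Scope ereal_scope.
Context d (T : measurableType d) (R : realType).
Variable m : {sigma_finite_measure set T -> \bar R}.
Notation mu := (@lebesgue_measure R).
Variables (w N : T -> R) (g G M : R -> R) (P : R).
Hypotheses (mw : measurable_fun setT w) (mN : measurable_fun setT N)
  (mg : measurable_fun setT (g : measurableTypeR R -> R)).
Hypotheses (w0 : forall x, (0 <= w x)%R) (N0 : forall x, (0 <= N x)%R)
  (g0 : forall s, (0 <= s <= P)%R -> (0 <= g s)%R).
Hypothesis wM : forall s, (0 <= s <= P)%R ->
  \int[m]_x (w x * (N x <= s)%R%:R)%:E = (M s)%:E.
Hypothesis gG : forall s, (0 <= s <= P)%R ->
  \int[mu]_(t in `[s, P]) (g t)%:E = (G s)%:E.

(** [G (N x)] is the integral of [g] over [[N x, P]]. Exchanging the two integrals leaves [g s]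
    times the weighted volume [M s] of the sublevel set of [N]. By hypothesis such a [G] vanishes at
    [P]. *)
Lemma layer_cake :
  \int[m]_x (w x * (N x <= P)%R%:R * G (N x))%:E =
  \int[mu]_(s in `[0%R, P]) (g s * M s)%:E.
Proof.
pose H (z : T * measurableTypeR R) : R :=
  (w z.1 * (N z.1 <= z.2)%R%:R * ((0 <= z.2 <= P)%R%:R * g z.2))%R.
have mH : measurable_fun setT (fun z => (H z)%:E).
  apply/measurable_EFinP; apply: measurable_funM; apply: measurable_funM.
  - exact: measurableT_comp.
  - by apply/measurable_natb/measurable_fun_ler => //; exact: measurableT_comp.
  - by apply/measurable_natb/measurable_and; apply/measurable_fun_ler;
      by [exact: measurable_snd|exact: measurable_cst].
  - exact: measurableT_comp.
have H0 z : 0 <= (H z)%:E.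
  rewrite lee_fin; apply: mulr_ge0; first exact: mulr_ge0.
  by have [/g0 ?|_] := boolP (0 <= z.2 <= P)%R; rewrite ?mul1r ?mul0r.
transitivity (\int[m]_x \int[mu]_s (H (x, s))%:E).
  apply: eq_integral => x _.
  have [NP|NP] := boolP (N x <= P)%R; last first.
    rewrite mulr0 mul0r integral0_eq// => s _; rewrite /H/=.
    have [Ns|_] := boolP (N x <= s)%R; last by rewrite mulr0 mul0r.
    rewrite (_ : (s <= P)%R = false) ?andbF ?mul0r ?mulr0//.
    by apply/negbTE; apply: contra NP; exact: le_trans.
  have Nx : (0 <= N x <= P)%R by rewrite N0.
  rewrite mulr1 EFinM -(gG Nx) -integral_itv_natb.
  rewrite -ge0_integralZl_EFin//; last 2 first.
  - move=> s _; rewrite lee_fin.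
    have [/andP[s1 s2]|_] := boolP (N x <= s <= P)%R; last by rewrite mul0r.
    by rewrite mul1r g0// s2 (le_trans _ s1).
  - apply/measurable_EFinP/measurable_funM => //.
    by apply/measurable_natb/measurable_and; apply/measurable_fun_ler => //.
  apply: eq_integral => s _; rewrite -EFinM /H/=; congr EFin.
  rewrite -mulrA; congr (_ * _)%R; rewrite mulrA; congr (_ * _)%R.
  have [Ns|_] := boolP (N x <= s)%R; last by rewrite mul0r.
  by rewrite (le_trans (N0 _) Ns) mul1r.
rewrite (fubini_tonelli (m1 := m) (m2 := mu) (fun z => (H z)%:E))//.
rewrite -integral_itv_natb; apply: eq_integral => s _.
have [sP|sP] := boolP (0 <= s <= P)%R; last first.
  rewrite mul0r integral0_eq// => x _.
  by rewrite /H/= (negbTE sP) mul0r mulr0.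
rewrite mul1r EFinM -(wM sP) -ge0_integralZl_EFin//; last 3 first.
- by move=> x _; rewrite lee_fin mulr_ge0.
- apply/measurable_EFinP/measurable_funM => //.
  by apply/measurable_natb/measurable_fun_ler.
- exact: g0.
by apply: eq_integral => x _; rewrite -EFinM /H/= sP mul1r mulrC.
Qed.

End layer_cake.

Section moments.
Local Open Scope ereal_scope.
Context (R : realType).
Notation mu := (@lebesgue_measure R).

Lemma is_derive_continuous (F : R -> R) (x k : R) :
  is_derive x (1 : R)%R F k -> {for x, continuous F}.
Proof.
by case=> dF _; apply: differentiable_continuous; exact/derivable1_diffP.
Qed.

Lemma integral_monomial (k a b : R) n : (a <= b)%R ->
  \int[mu]_(s in `[a, b]) (k * s ^+ n)%:E =
  (k / n.+1%:R * (b ^+ n.+1 - a ^+ n.+1))%:E.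
Proof.
move=> ab; pose p : {poly R} := ((k / n.+1%:R) *: 'X^(n.+1))%R.
have dp (x : R) : is_derive x (1 : R)%R (horner p) (k * x ^+ n)%R.
  apply: is_derive_eq; rewrite /p derivZ derivXn hornerZ hornerMn hornerXn/=.
  by rewrite -[(x ^+ n *+ _)%R]mulr_natl mulrA divfK ?pnatr_eq0.
rewrite (integral_is_derive (F := horner p))//.
- by rewrite /p !hornerZ !hornerXn mulrBr.
- by move=> x _; apply: cvgM; [exact: cvg_cst|exact: exprn_continuous].
- by move=> x _; exact: is_derive_continuous.
Qed.

Context d (T : measurableType d).
Variable m : {sigma_finite_measure set T -> \bar R}.
Variables (w N : T -> R) (c P : R).
Hypotheses (mw : measurable_fun setT w) (mN : measurable_fun setT N).
Hypotheses (w0 : forall x, (0 <= w x)%R) (N0 : forall x, (0 <= N x)%R)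
  (P0 : (0 <= P)%R).
Hypothesis wN : forall s, (0 <= s <= P)%R ->
  \int[m]_x (w x * (N x <= s)%R%:R)%:E = (c * s ^+ 3)%:E.

(** The layer-cake formula wants a function vanishing at [P], so it is applied to P^(n+1) - N^(n+1),
    and the result is subtracted from the integral of the constant P^(n+1). The factor is 3/(n+4) =
    1 - (n+1)/(n+4); n = 0 gives the 3/4 of the averages of |p| and |q|. *)
Lemma moment n :
  \int[m]_x (w x * (N x <= P)%R%:R * N x ^+ n.+1)%:E =
  (c * 3 / n.+4%:R * P ^+ n.+4)%:E.
Proof.
have L := @layer_cake _ T R m w N (fun s => n.+1%:R * s ^+ n)%R
  (fun s => P ^+ n.+1 - s ^+ n.+1)%R (fun s => c * s ^+ 3)%R P
  mw mN _ w0 N0 _ wN _.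
have {L} : \int[m]_x (w x * (N x <= P)%R%:R * (P ^+ n.+1 - N x ^+ n.+1))%:E =
    (n.+1%:R * c / n.+4%:R * P ^+ n.+4)%:E.
  rewrite L.
  - transitivity (\int[mu]_(s in `[0%R, P]) (n.+1%:R * c * s ^+ n.+3)%:E).
      apply: eq_integral => s _; congr EFin.
      by rewrite -[n.+3]addn3 exprD; ring.
    by rewrite integral_monomial// expr0n subr0.
  - by apply: measurable_funM => //; exact: exprn_measurable.
  - by move=> s /andP[s0 _]; rewrite mulr_ge0// exprn_ge0.
  - move=> s /andP[_ sP]; rewrite integral_monomial//.
    by rewrite divff// mul1r.
have mwN : measurable_fun setT (fun x => w x * (N x <= P)%R%:R)%R.
  apply: measurable_funM => //.
  by apply/measurable_natb/measurable_fun_ler => //.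
have mNn : measurable_fun setT (fun x => w x * (N x <= P)%R%:R * N x ^+ n.+1)%R.
  by apply: measurable_funM => //; exact: measurable_funX.
have : \int[m]_x (w x * (N x <= P)%R%:R * P ^+ n.+1)%:E =
    (c * P ^+ n.+4)%:E.
  under eq_integral do rewrite mulrC EFinM.
  rewrite ge0_integralZl_EFin//.
  - rewrite wN ?P0 ?lexx// -EFinM; congr EFin.
    by rewrite -[n.+4]/(3 + n.+1)%N exprD; ring.
  - by move=> x _; rewrite lee_fin mulr_ge0.
  - exact/measurable_EFinP.
  - exact: exprn_ge0.
have -> : \int[m]_x (w x * (N x <= P)%R%:R * P ^+ n.+1)%:E =
    \int[m]_x (w x * (N x <= P)%R%:R * N x ^+ n.+1)%:E +
    \int[m]_x (w x * (N x <= P)%R%:R * (P ^+ n.+1 - N x ^+ n.+1))%:E.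
  rewrite -ge0_integralD//.
  - by apply: eq_integral => x _; rewrite -EFinD; congr EFin; ring.
  - by move=> x _; rewrite lee_fin !mulr_ge0// exprn_ge0.
  - exact/measurable_EFinP.
  - move=> x _; rewrite lee_fin.
    have [NP|_] := boolP (N x <= P)%R; last by rewrite mulr0 mul0r.
    rewrite !mulr_ge0// subr_ge0 lerXn2r// nnegrE//.
  - apply/measurable_EFinP; apply: measurable_funM => //.
    by apply: measurable_funB => //; exact: measurable_funX.
(* The moment is the unknown term of a sum whose value is finite, so it is a real number [x] and can
   be solved for. *)
move=> + LE; rewrite LE; case: (integral _ _ _) => // x [] xE; congr EFin.
rewrite -(addrK (n.+1%:R * c / n.+4%:R * P ^+ n.+4)%R x) xE.
have n4 : (n.+4%:R != 0 :> R)%R by rewrite pnatr_eq0.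
have -> : (n.+1%:R = n.+4%:R - 3 :> R)%R.
  by rewrite -[n.+4]/(3 + n.+1)%N natrD addrC addKr.
by move: n.+4%:R%R n4 => k k0; field.
Qed.

End moments.

(** * Areas and axial potentials of disks *)

Section disks.
Local Open Scope ereal_scope.
Context (R : realType).
Notation mu := (@lebesgue_measure R).
Notation plane := (measurableTypeR R * measurableTypeR R)%type.

(** The radius is kept squared, here and in [disk_area]: areas are linear in it, and the slices of a
    ball are sublevel sets of [rho2]. *)
Definition rho2 (x : plane) : R := (x.1 ^+ 2 + x.2 ^+ 2)%R.

Lemma rho2_ge0 x : (0 <= rho2 x)%R.
Proof. by rewrite addr_ge0// sqr_ge0. Qed.

Lemma measurable_rho2 : measurable_fun setT rho2.
Proof. by apply: measurable_funD; apply: measurable_funX. Qed.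

Definition disk_area (s : R) : \bar R := \int[leb2 R]_x ((rho2 x <= s)%R%:R)%:E.

Lemma measurable_disk_indicator (s : R) :
  measurable_fun setT (fun x => ((rho2 x <= s)%R%:R)%:E : \bar R).
Proof.
apply/measurable_EFinP/measurable_natb/measurable_fun_ler => //.
exact: measurable_rho2.
Qed.

Lemma disk_area1_lty : disk_area 1 < +oo.
Proof.
pose Q : set plane := (`[-1, 1] `*` `[-1, 1])%R.
have mQ : measurable Q by exact: measurableX.
apply: (@le_lt_trans _ _ (\int[leb2 R]_x (\1_Q x)%:E)).
  apply: ge0_le_integral => //.
  - exact: measurable_disk_indicator.
  - exact/measurable_EFinP/measurable_indic.
  - move=> [x y] _; rewrite lee_fin indicE.
    have [|] := boolP (_ \in Q); first by move=> _; rewrite ler_nat leq_b1.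
    rewrite notin_setE /Q/= !in_itv/= => xyQ.
    have [xy1|//] := boolP (rho2 (x, y) <= 1)%R.
    exfalso; apply: xyQ; rewrite /rho2/= in xy1.
    by split; apply/andP; split; nra.
rewrite integral_indic// setIT.
have QE : leb2 R Q = mu [set` `[-1, 1]%R] * mu [set` `[-1, 1]%R].
  exact: product_measure1E.
suff : leb2 R Q < +oo by [].
rewrite QE.
by rewrite lebesgue_measure_itv/= lte_fin; case: ifP => _;
  rewrite ?mule0 ?ltry// -EFinD -EFinM ltry.
Qed.

(* This is pi, but its value is irrelevant: it cancels out. *)
Definition unit_disk_area : R := fine (disk_area 1).
Notation b2 := unit_disk_area.

Lemma unit_disk_area_ge0 : (0 <= b2)%R.
Proof. by apply: fine_ge0; apply: integral_ge0 => x _; rewrite lee_fin. Qed.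

Lemma disk_area1E : disk_area 1 = b2%:E.
Proof.
by rewrite fineK// ge0_fin_numE ?disk_area1_lty//; apply: integral_ge0.
Qed.

Lemma disk_area_dilation (a s : R) : (0 < a)%R ->
  disk_area (a ^+ 2 * s) = (a ^+ 2)%:E * disk_area s.
Proof.
move=> a0; rewrite /disk_area (integral_dilation2 a0)//; last first.
  exact: measurable_disk_indicator.
congr (_ * _); apply: eq_integral => x _; rewrite /rho2/= !exprMn -mulrDr.
by rewrite ler_pM2l// exprn_gt0.
Qed.

Lemma eq_mule_eq0 (a : R) (x : \bar R) : (a != 1)%R -> x \is a fin_num ->
  x = a%:E * x -> x = 0.
Proof.
move=> a1; case: x => [x| |]//= _ [] /eqP.
rewrite -subr_eq0 -{1}(mul1r x) -mulrBl mulf_eq0 subr_eq0 eq_sym (negbTE a1)/=.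
by move=> /eqP ->.
Qed.

(** The degenerate disk is unchanged by the dilation of factor 2, so its area, which is finite,
    equals 4 times itself. *)
Lemma disk_area0 : disk_area 0 = 0.
Proof.
apply: (@eq_mule_eq0 (2 ^+ 2)); first by apply/negP => /eqP; lra.
  rewrite ge0_fin_numE; last exact: integral_ge0.
  apply: le_lt_trans disk_area1_lty; apply: ge0_le_integral => //.
  - exact: measurable_disk_indicator.
  - exact: measurable_disk_indicator.
  - move=> x _; rewrite lee_fin ler_nat.
    by case: (boolP (rho2 x <= 0)%R) => // /le_trans ->.
by rewrite -disk_area_dilation// mulr0.
Qed.

Lemma disk_areaE (s : R) : (0 <= s)%R -> disk_area s = (b2 * s)%:E.
Proof.
rewrite le_eqVlt => /predU1P[<-|s0]; first by rewrite disk_area0 mulr0.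
rewrite -{1}(sqr_sqrtr (ltW s0)) -[(_ ^+ 2)%R]mulr1.
rewrite disk_area_dilation ?sqrtr_gt0//.
by rewrite disk_area1E sqr_sqrtr ?ltW// -EFinM mulrC.
Qed.

(** This is the potential of a uniform disk at a point of its axis, at distance sqrt D from the
    centre. The layer-cake formula applies to 1/r minus its value at the rim; the rim value times
    the area of the disk is then added back. *)
Lemma disk_potential (D T : R) : (0 < D)%R -> (0 <= T)%R ->
  \int[leb2 R]_x ((rho2 x <= T)%R%:R * (Num.sqrt (rho2 x + D))^-1)%:E =
  (2 * b2 * (Num.sqrt (T + D) - Num.sqrt D))%:E.
Proof.
move=> D0 T0.
pose r (s : R) := Num.sqrt (s + D).
have r0 (s : R) : (0 <= s)%R -> (0 < r s)%R.
  by move=> s0; rewrite /r sqrtr_gt0 (lt_le_trans D0)// lerDr.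
have rr (s : R) : (0 <= s)%R -> (r s ^+ 2 = s + D)%R.
  by move=> s0; rewrite sqr_sqrtr// addr_ge0// ltW.
have dr (s : R) : (0 <= s)%R -> is_derive s (1 : R)%R r (2 * r s)^-1%R.
  move=> s0.
  have sD : (0 < s + D)%R by rewrite (lt_le_trans D0)// lerDr.
  have dD : is_derive s (1 : R)%R (fun s : R => s + D)%R 1%R.
    by apply: is_derive_eq; rewrite addr0.
  have := @is_derive1_comp _ Num.sqrt (fun s : R => s + D)%R s _ _
    (is_derive1_sqrt sD) dD.
  by rewrite mulr1.
have cr (s : R) : (0 <= s)%R -> {for s, continuous r}.
  by move=> s0; exact: is_derive_continuous (dr s s0).
have dV (s : R) : (0 <= s)%R -> is_derive s (1 : R)%R (fun s => (r s)^-1)%R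
    (- (2 * r s ^+ 3)^-1)%R.
  move=> s0; apply: is_derive_eq.
    by apply: is_deriveV; [rewrite gt_eqF// r0|exact: dr].
  by have := r0 s s0 => rs; rewrite /GRing.scale/=; field; rewrite gt_eqF.
(* Minus the derivative of 1/r, positive because 1/r decreases. *)
pose g (s : R) := (2 * r s ^+ 3)^-1%R.
have cg (s : R) : (0 <= s)%R -> {for s, continuous g}.
  move=> s0; apply: cvgV; first by rewrite mulf_neq0// expf_neq0 ?gt_eqF// r0.
  apply: cvgM; first exact: cvg_cst.
  exact: (continuous_comp (cr s s0) (@exprn_continuous _ 3 (r s))).
have L := @layer_cake _ plane R (leb2 R) (cst 1%R) rho2 g
  (fun s => (r s)^-1 - (r T)^-1)%R (fun s => b2 * s)%R T.
have {L} : \int[leb2 R]_x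
      (1 * (rho2 x <= T)%R%:R * ((r (rho2 x))^-1 - (r T)^-1))%:E =
    (b2 * ((r T + D / r T) - (r 0 + D / r 0)))%:E.
  rewrite L//.
  - transitivity ((b2 * (r T + D / r T) - b2 * (r 0 + D / r 0))%:E)%R; last first.
      by rewrite mulrBr.
    (* In the variable r, with s = r^2 - D, the form s ds / (2 r^3) becomes (1 - D / r^2) dr, whose
       primitive is r + D / r. *)
    apply: (@integral_is_derive _ _ (fun s => b2 * (r s + D / r s))%R) => //.
    + move=> s /[!in_itv]/= /andP[s0 _]; apply: cvgM; first exact: cg.
      by apply: cvgM; [exact: cvg_cst|exact: cvg_id].
    + move=> s /[!in_itv]/= /andP[s0 _]; apply: cvgM; first exact: cvg_cst.
      apply: cvgD; first exact: cr.
      apply: cvgM; first exact: cvg_cst.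
      by apply: cvgV; [rewrite gt_eqF// r0|exact: cr].
    + move=> s /[!in_itv]/= /andP[/ltW s0 _].
      have := dr s s0 => dr1; have := dV s s0 => dV1.
      have H := is_deriveZ b2 (is_deriveD dr1 (is_deriveZ D dV1)).
      apply: (is_derive_eq H).
      have := r0 s s0 => rs; rewrite /g /GRing.scale/=.
      have -> : D = (r s ^+ 2 - s)%R by rewrite rr// addrC addKr.
      by field; rewrite gt_eqF.
  - exact: measurable_rho2.
  - apply: measurable_invr; apply: measurable_funM => //.
    by apply: measurable_funX; apply: measurable_sqrt; exact: measurable_funD.
  - by move=> x; exact: rho2_ge0.
  - move=> s /andP[s0 _]; rewrite invr_ge0 mulr_ge0// exprn_ge0//.
    exact: sqrtr_ge0.
  - move=> s /andP[s0 _]; rewrite -disk_areaE//.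
    by apply: eq_integral => x _; rewrite mul1r.
  - move=> s /andP[s0 sT].
    transitivity ((- (r T)^-1 - - (r s)^-1)%:E)%R; last by rewrite opprK addrC.
    apply: (@integral_is_derive _ _ (fun s => - (r s)^-1)%R) => //.
    + by move=> t /[!in_itv]/= /andP[st _]; apply: cg; exact: le_trans st.
    + move=> t /[!in_itv]/= /andP[st _]; apply: cvgN.
      have t0 := le_trans s0 st.
      by apply: cvgV; [rewrite gt_eqF// r0|exact: cr].
    + move=> t /[!in_itv]/= /andP[/ltW st _].
      have := dV t (le_trans s0 st) => dV1.
      by apply: is_derive_eq; rewrite opprK.
have m1 : measurable_fun setT (fun x : plane => (rho2 x <= T)%R%:R : R).
  by apply/measurable_natb/measurable_fun_ler => //; exact: measurable_rho2.
have m2 : measurable_fun setT (fun x : plane => (r (rho2 x))^-1)%R.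
  apply: measurable_invr; apply: measurable_sqrt; apply: measurable_funD => //.
  exact: measurable_rho2.
move=> LE.
transitivity (\int[leb2 R]_x
    (1 * (rho2 x <= T)%R%:R * ((r (rho2 x))^-1 - (r T)^-1))%:E +
  \int[leb2 R]_x ((r T)^-1 * (rho2 x <= T)%R%:R)%:E).
  rewrite -ge0_integralD//.
  - by apply: eq_integral => x _; rewrite -EFinD /r; congr EFin; ring.
  - move=> x _; rewrite lee_fin mul1r.
    have [xT|_] := boolP (rho2 x <= T)%R; last by rewrite mul0r.
    rewrite mul1r subr_ge0 lef_pV2 ?posrE ?r0 ?rho2_ge0//.
    by rewrite ler_wsqrtr// lerD2r.
  - apply/measurable_EFinP; apply: measurable_funM.
      exact: measurable_funM.
    exact: measurable_funB.
  - by move=> x _; rewrite lee_fin mulr_ge0// invr_ge0 sqrtr_ge0.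
  - exact/measurable_EFinP/measurable_funM.
rewrite LE; under eq_integral do rewrite EFinM.
rewrite ge0_integralZl_EFin//; last 2 first.
- exact: measurable_disk_indicator.
- by rewrite invr_ge0 sqrtr_ge0.
rewrite -/(disk_area T) disk_areaE// -EFinM -EFinD; congr EFin.
have -> : Num.sqrt (T + D) = r T by [].
have -> : Num.sqrt D = r 0%R by rewrite /r add0r.
have := r0 0%R (lexx _) => r00; have := r0 T T0 => rT.
have De : D = (r 0 ^+ 2)%R by rewrite rr// add0r.
have Te : T = (r T ^+ 2 - r 0 ^+ 2)%R by rewrite !rr// add0r addrK.
move: (r T) (r 0%R) Te De r00 rT => x y -> -> y0 x0.
by field; rewrite !gt_eqF.
Qed.

End disks.

(** * Volumes of balls and cones, and the potential on a sphere *)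

Section balls.
Local Open Scope ereal_scope.
Context (R : realType).
Notation mu := (@lebesgue_measure R).
Notation b2 := (@unit_disk_area R).
Implicit Types (x u : vec3 R) (s h a : R).

Lemma integral_poly (p : {poly R}) (a b : R) : (a <= b)%R ->
  \int[mu]_(x in `[a, b]) ((p^`()).[x])%:E = (p.[b] - p.[a])%:E.
Proof.
move=> ab; apply: (@integral_is_derive _ (horner p^`()) (horner p)) => //.
- by move=> x _; exact: continuous_horner.
- by move=> x _; exact: continuous_horner.
Qed.

Lemma norm3_le x s : (0 <= s)%R -> (norm3 x <= s)%R = (dot3 x x <= s ^+ 2)%R.
Proof.
by move=> s0; rewrite -sqr_norm3 ler_pXn2r// nnegrE norm3_ge0.
Qed.

Lemma norm3_slice (xy : measurableTypeR R * measurableTypeR R)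
    (z : measurableTypeR R) s : (0 <= s)%R ->
  (norm3 (xy, z) <= s)%R = (rho2 xy <= s ^+ 2 - z ^+ 2)%R.
Proof.
move=> s0; rewrite norm3_le// lerBrDr; congr (_ <= _)%R.
Qed.

Lemma integral_ball s : (0 <= s)%R ->
  \int[leb3 R]_x ((norm3 x <= s)%R%:R)%:E = (4 / 3 * b2 * s ^+ 3)%:E.
Proof.
move=> s0; rewrite integral_leb3//; last first.
  apply/measurable_EFinP/measurable_natb/measurable_fun_ler => //.
  exact: measurable_norm3.
(* The slice at height z is a disk of squared radius s^2 - z^2; [p] is a primitive of its area. *)
pose p : {poly R} := (b2 *: ((s ^+ 2) *: 'X - 3^-1 *: 'X^3))%R.
transitivity (\int[mu]_(z in `[(- s)%R, s]) ((p^`()).[z])%:E); last first.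
  rewrite integral_poly; last lra.
  congr EFin; rewrite /p !(hornerZ, hornerD, hornerN, hornerX, hornerXn).
  by field.
rewrite -integral_itv_natb; apply: eq_integral => z _.
under eq_integral do rewrite (norm3_slice _ _ s0).
have -> : (p^`()).[z]%R = (b2 * (s ^+ 2 - z ^+ 2))%R.
  rewrite /p !(derivZ, derivD, derivN, derivX, derivXn).
  rewrite !(hornerZ, hornerD, hornerN, hornerMn, hornerXn).
  by rewrite -[1%R]/(1%:P)%R hornerC/=; field.
have [zs|zs] := boolP (- s <= z <= s)%R.
  rewrite mul1r -disk_areaE//.
  by move: zs => /andP[z1 z2]; nra.
rewrite mul0r integral0_eq// => x _.
have [xs|//] := boolP (rho2 x <= s ^+ 2 - z ^+ 2)%R.
exfalso; move/negP: zs; apply; have := rho2_ge0 x.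
by move: xs s0 => *; apply/andP; split; nra.
Qed.

Lemma dot3_dilation (k : R) x u :
  dot3 (k * x.1.1, k * x.1.2, k * x.2)%R u = (k * dot3 x u)%R.
Proof. by rewrite /dot3/=; ring. Qed.

Lemma norm3_dilation (k : R) x : (0 <= k)%R ->
  norm3 (k * x.1.1, k * x.1.2, k * x.2)%R = (k * norm3 x)%R.
Proof.
move=> k0; rewrite /norm3 dot3_dilation dot3C dot3_dilation mulrA -expr2.
by rewrite sqrtrM ?sqr_ge0// sqrtr_sqr ger0_norm.
Qed.

(** The quotient [x.2 / norm3 x] is the cosine of the angle between [x] and the polar axis. *)
Definition cone_volume a s : \bar R :=
  \int[leb3 R]_x ((norm3 x <= s)%R%:R * (x.2 / norm3 x <= a)%R%:R)%:E.

(** For a between -1 and 1 this is 2 pi (1 + a) / 3, a value that cancels like the area of the unit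
    disk. *)
Definition unit_cone_volume a : R := fine (cone_volume a 1).

Lemma measurable_cone a s : measurable_fun setT (fun x =>
  ((norm3 x <= s)%R%:R * (x.2 / norm3 x <= a)%R%:R)%:E : \bar R).
Proof.
apply/measurable_EFinP/measurable_funM.
  by apply/measurable_natb/measurable_fun_ler => //; exact: measurable_norm3.
apply/measurable_natb/measurable_fun_ler => //; apply: measurable_funM => //.
by apply: measurable_invr; exact: measurable_norm3.
Qed.

Lemma cone_volume_fin_num a s : (0 <= s)%R -> cone_volume a s \is a fin_num.
Proof.
move=> s0; rewrite ge0_fin_numE; last by apply: integral_ge0.
apply: (@le_lt_trans _ _ (\int[leb3 R]_x ((norm3 x <= s)%R%:R)%:E)).
  apply: ge0_le_integral => //.
  - exact: measurable_cone.
  - apply/measurable_EFinP/measurable_natb/measurable_fun_ler => //.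
    exact: measurable_norm3.
  - by move=> x _; rewrite lee_fin ler_piMr// lern1 leq_b1.
by rewrite integral_ball// ltry.
Qed.

Lemma cone_volume_dilation a k s : (0 < k)%R ->
  cone_volume a (k * s) = (k ^+ 3)%:E * cone_volume a s.
Proof.
move=> k0; rewrite /cone_volume (integral_dilation3 k0)//; last first.
  exact: measurable_cone.
congr (_ * _); apply: eq_integral => x _; rewrite (norm3_dilation _ (ltW k0))/=.
by rewrite ler_pM2l// invfM mulrACA divff ?gt_eqF// mul1r.
Qed.

Lemma cone_volumeE a s : (0 <= s)%R ->
  cone_volume a s = (unit_cone_volume a * s ^+ 3)%:E.
Proof.
rewrite le_eqVlt => /predU1P[<-|s0].
  rewrite expr0n mulr0; apply: (@eq_mule_eq0 _ (2 ^+ 3)).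
  - by apply/negP => /eqP; lra.
  - exact: cone_volume_fin_num.
  - by rewrite -cone_volume_dilation// mulr0.
rewrite -{1}[s]mulr1 cone_volume_dilation// [RHS]EFinM /unit_cone_volume.
by rewrite fineK ?cone_volume_fin_num// muleC.
Qed.

Lemma norm3_eq0 x : (norm3 x == 0)%R = (x == 0%R).
Proof.
rewrite sqrtr_eq0; apply/idP/eqP => [|->]; last by rewrite /dot3 /= !mul0r !addr0.
case: x => -[x y] z; rewrite /dot3/= => xyz.
have [x2 y2] := (sqr_ge0 x, sqr_ge0 y); have z2 := sqr_ge0 z.
have -> : x = 0%R by apply/eqP; rewrite -sqrf_eq0; apply/eqP; lra.
have -> : y = 0%R by apply/eqP; rewrite -sqrf_eq0; apply/eqP; lra.
by have -> : z = 0%R by apply/eqP; rewrite -sqrf_eq0; apply/eqP; lra.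
Qed.

Lemma norm3_gt0 x : x != 0%R -> (0 < norm3 x)%R.
Proof. by rewrite lt0r norm3_ge0 norm3_eq0 andbT. Qed.

Lemma dot3_pole x (h : R) : dot3 x (0, 0, h)%R = (x.2 * h)%R.
Proof. by rewrite /dot3/= !mulr0 !add0r. Qed.

(** This makes the spatial marginal uniform. The integrand is zonal, so [u] may be moved to the
    pole, where its length drops out of the cosine. *)
Lemma integral_cone a s u : (0 <= s)%R -> u != 0%R ->
  \int[leb3 R]_x ((norm3 x <= s)%R%:R *
    (dot3 x u / (norm3 x * norm3 u) <= a)%R%:R)%:E =
  (unit_cone_volume a * s ^+ 3)%:E.
Proof.
move=> s0 u0; have h0 := norm3_gt0 u0.
pose G (n d : R) : R := ((n <= s)%R%:R * (d / (n * norm3 u) <= a)%R%:R)%R.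
have mG : measurable_fun setT
    (fun z : measurableTypeR R * measurableTypeR R => G z.1 z.2).
  apply: measurable_funM; apply/measurable_natb/measurable_fun_ler => //.
  apply: measurable_funM => //; apply: measurable_invr.
  exact: measurable_funM.
have G0 n d : (0 <= G n d)%R by exact: mulr_ge0.
rewrite -cone_volumeE//.
rewrite [LHS](zonal_pole mG G0 u); apply: eq_integral => x _.
rewrite /G dot3_pole; congr ((_ * (_ <= _)%R%:R)%:E)%R.
by rewrite invfM mulrACA divff ?mulr1// gt_eqF.
Qed.

Lemma norm3B u x :
  norm3 (u - x)%R = Num.sqrt (norm3 u ^+ 2 + norm3 x ^+ 2 - 2 * dot3 x u)%R.
Proof.
rewrite /norm3 !sqr_norm3; congr Num.sqrt.
by case: u x => -[u1 u2] u3 [[x1 x2] x3]; rewrite /dot3/=; ring.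
Qed.

(* With u moved to the pole (0, 0, h), the slice of the ball at height z
   contributes 2 pi (sqrt (2 h^2 - 2 h z) - (h - z)).  Restricting to points u
   of the boundary sphere makes h - z nonnegative on the whole ball. *)
Lemma surface_potential u :
  \int[leb3 R]_x ((norm3 x <= norm3 u)%R%:R * (norm3 (u - x))^-1)%:E =
  (4 / 3 * b2 * norm3 u ^+ 2)%:E.
Proof.
have [->|u0] := eqVneq u 0%R.
  have n0 : norm3 (0 : vec3 R)%R = 0%R by apply/eqP; rewrite norm3_eq0.
  rewrite n0 expr0n/= mulr0 integral0_eq// => x _.
  have [x0|_] := boolP (norm3 x <= 0)%R; last by rewrite mul0r.
  have /eqP -> : x == 0%R by rewrite -norm3_eq0 eq_le x0 norm3_ge0.
  by rewrite subrr n0 invr0 mulr0.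
have := norm3_gt0 u0; set h := norm3 u => h0.
pose G (n d : R) : R :=
  ((n <= h)%R%:R * (Num.sqrt (h ^+ 2 + n ^+ 2 - 2 * d))^-1)%R.
have mG : measurable_fun setT
    (fun z : measurableTypeR R * measurableTypeR R => G z.1 z.2).
  apply: measurable_funM; first by apply/measurable_natb/measurable_fun_ler.
  apply: measurable_invr; apply: measurable_sqrt; apply: measurable_funB.
    by apply: measurable_funD => //; exact: measurable_funX.
  exact: measurable_funM.
have G0 n d : (0 <= G n d)%R by rewrite mulr_ge0// invr_ge0 sqrtr_ge0.
transitivity (zonal G u).
  by apply: eq_integral => x _; rewrite norm3B.
rewrite (zonal_pole mG G0) /zonal integral_leb3//; last 2 first.
- exact: measurable_zonal.
- by move=> x; rewrite lee_fin.
(* The squared distance from the pole to the rim of the slice at height z, a circle on the sphere of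
   radius h. *)
pose v (z : R) : R := (2 * h ^+ 2 - 2 * h * z)%R.
(* Since v' = -2h, a primitive of sqrt v is -v^(3/2) / (3h), with v^(3/2) written as v times sqrt
   v. *)
pose F (z : R) : R :=
  (2 * b2 * (- (3 * h)^-1 * (v z * Num.sqrt (v z)) + 2^-1 * (h - z) ^+ 2))%R.
pose f (z : R) : R := (2 * b2 * (Num.sqrt (v z) - (h - z)))%R.
have sqrt4 : (Num.sqrt (4 * h ^+ 2) = 2 * h)%R.
  have -> : (4 * h ^+ 2 = (2 * h) ^+ 2)%R by ring.
  by rewrite sqrtr_sqr ger0_norm//; lra.
transitivity (\int[mu]_(z in `[(- h)%R, h]) (f z)%:E); last first.
  transitivity ((F h - F (- h))%:E)%R; last first.
    rewrite /F (_ : v h = 0)%R; last by rewrite /v; ring.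
    rewrite (_ : v (- h) = 4 * h ^+ 2)%R; last by rewrite /v; ring.
    by rewrite sqrt4 sqrtr0; congr EFin; field; rewrite gt_eqF.
  have cv : continuous v.
    move=> z; apply: cvgB; first exact: cvg_cst.
    by apply: cvgM; [exact: cvg_cst|exact: cvg_id].
  have cs : continuous (fun z => Num.sqrt (v z)).
    by move=> z; exact: (continuous_comp (cv z) (@sqrt_continuous _ (v z))).
  have chz : continuous (fun z : R => h - z)%R.
    by move=> z; apply: cvgB; [exact: cvg_cst|exact: cvg_id].
  have hh : (- h <= h)%R by lra.
  apply: (@integral_is_derive _ f F _ _ hh).
  - move=> z _; apply: cvgM; first exact: cvg_cst.
    by apply: cvgB; [exact: cs|exact: chz].
  - move=> z _; apply: cvgM; first exact: cvg_cst.
    apply: cvgD; (apply: cvgM; first exact: cvg_cst).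
      by apply: cvgM; [exact: cv|exact: cs].
    exact: (continuous_comp (chz z) (@exprn_continuous _ 2 (h - z)%R)).
  - move=> z /[!in_itv]/= /andP[_ zh].
    have vz : (0 < v z)%R by rewrite /v; nra.
    have dv : is_derive z (1 : R)%R v (- (2 * h))%R.
      have Hv := is_deriveB (is_derive_cst (2 * h ^+ 2)%R z (1 : R)%R)
        (is_deriveZ (2 * h)%R (is_derive_id z (1 : R)%R)).
      by apply: (is_derive_eq Hv); rewrite /GRing.scale/= mulr1 sub0r.
    have ds := @is_derive1_comp _ Num.sqrt v z _ _ (is_derive1_sqrt vz) dv.
    have dh : is_derive z (1 : R)%R (fun z : R => h - z)%R (-1)%R.
      have Hh := is_deriveB (is_derive_cst h z (1 : R)%R)
        (is_derive_id z (1 : R)%R).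
      by apply: (is_derive_eq Hh); rewrite sub0r.
    have H := is_deriveZ (2 * b2)%R (is_deriveD
      (is_deriveZ (- (3 * h)^-1)%R (is_deriveM dv ds))
      (is_deriveZ 2^-1%R (is_deriveX 2 dh))).
    apply: (is_derive_eq H); rewrite /GRing.scale/=.
    have sv : (0 < Num.sqrt (v z))%R by rewrite sqrtr_gt0.
    have := sqr_sqrtr (ltW vz); rewrite /f.
    move: (Num.sqrt (v z)) sv => q q0 <-.
    by field; rewrite !gt_eqF.
rewrite -integral_itv_natb; apply: eq_integral => z _.
rewrite /G.
under eq_integral => xy _.
  rewrite (norm3_slice _ _ (ltW h0)) dot3_pole/= sqr_norm3.
  rewrite (_ : (h ^+ 2 + _ - _ = rho2 xy + (h - z) ^+ 2)%R); last first.
    by rewrite -/h /dot3/rho2/=; ring.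
  over.
have [/andP[z1 z2]|zs] := boolP (- h <= z <= h)%R; last first.
  rewrite mul0r integral0_eq// => x _.
  have [xs|_] := boolP (_ <= _)%R; last by rewrite mul0r.
  exfalso; move/negP: zs; apply; have := rho2_ge0 x.
  by move: xs h0 => *; apply/andP; split; nra.
rewrite mul1r; move: z2; rewrite le_eqVlt => /predU1P[zh|zh].
  (* The polar slice is the single point x = u, where 1 / 0 = 0. *)
  have fh : f h = 0%R.
    rewrite /f (_ : v h = 0)%R ?sqrtr0 ?subrr ?subr0 ?mulr0//.
    by rewrite /v; ring.
  rewrite zh fh integral0_eq// => x _; rewrite !subrr.
  have [xs|_] := boolP (_ <= _)%R; last by rewrite mul0r.
  rewrite (_ : rho2 x = 0)%R ?expr0n ?addr0 ?sqrtr0 ?invr0 ?mulr0//.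
  by apply/eqP; rewrite eq_le xs rho2_ge0.
(* Here T = h^2 - z^2 and D = (h - z)^2, so that T + D is [v z]. *)
rewrite disk_potential; last 2 first.
- by rewrite exprn_gt0// subr_gt0.
- nra.
rewrite /f /v sqrtr_sqr ger0_norm; last by rewrite subr_ge0 ltW.
by congr ((_ * (Num.sqrt _ - _))%:E)%R; ring.
Qed.

End balls.

(** * The density and its momentum slices *)

Section cone_density.
Context (R : realType).
Implicit Types (x y u p q : vec3 R) (z : phase R).

(** Lagrange's identity: the difference of the two sides is the squared norm of the cross
    product. *)
Lemma dot3_sqr_le x y : dot3 x y ^+ 2 <= (norm3 x * norm3 y) ^+ 2.
Proof.
rewrite exprMn !sqr_norm3 -subr_ge0.
case: x y => -[x1 x2] x3 [[y1 y2] y3]; rewrite /dot3/=.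
rewrite (_ : _ - _ = (x1 * y2 - x2 * y1) ^+ 2 + (x1 * y3 - x3 * y1) ^+ 2 +
  (x2 * y3 - x3 * y2) ^+ 2); last by ring.
by rewrite !addr_ge0// sqr_ge0.
Qed.

Lemma dot3_norm_le x y : `|dot3 x y| <= norm3 x * norm3 y.
Proof.
have xy0 : 0 <= norm3 x * norm3 y by rewrite mulr_ge0// norm3_ge0.
rewrite -(ler_pXn2r (n := 2))// ?nnegrE// real_normK ?num_real//.
exact: dot3_sqr_le.
Qed.

Lemma cos_angle x y : cos (angle x y) = dot3 x y / (norm3 x * norm3 y).
Proof.
rewrite acosK// in_itv/= -ler_norml normrM normfV.
have xy0 : 0 <= norm3 x * norm3 y by rewrite mulr_ge0// norm3_ge0.
rewrite (ger0_norm xy0).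
have := dot3_norm_le x y; move: xy0; rewrite le_eqVlt => /predU1P[<- _|xy0].
  by rewrite invr0 mulr0.
by rewrite ler_pdivrMr// mul1r.
Qed.

Definition cone_indicator (P a : R) z : R :=
  (dot3 z.1 z.2 / (norm3 z.1 * norm3 z.2) <= a)%R%:R * (norm3 z.1 <= P)%R%:R.

(** Norms are nonnegative and cosines at least -1, so only the upper ends of the three intervals
    remain. *)
Lemma cone_densityE (r P a C : R) z :
  cone_density r P a C z =
  C * (norm3 z.2 <= r)%R%:R * cone_indicator P a z.
Proof.
rewrite /cone_density /cone_indicator !indicE !mem_setE !in_itv/= !norm3_ge0/=.
rewrite cos_angle (_ : (-1 <= _) = true) ?andTb; first by ring.
by rewrite -cos_angle cos_geN1.
Qed.

Section measurability.
Local Open Scope ereal_scope.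

Lemma measurable_cone_indicator (P a : R) :
  measurable_fun setT (cone_indicator P a).
Proof.
have m1 : measurable_fun setT (fun z : phase R => z.1) by exact: measurable_fst.
have m2 : measurable_fun setT (fun z : phase R => z.2) by exact: measurable_snd.
apply: measurable_funM; apply/measurable_natb/measurable_fun_ler => //.
  apply: measurable_funM; first exact: measurable_dot3.
  by apply: measurable_invr; apply: measurable_funM; exact: measurable_norm3.
exact: measurable_norm3.
Qed.

Lemma measurable_ball_indicator (r : R) :
  measurable_fun setT (fun x : vec3 R => (norm3 x <= r)%R%:R : R).
Proof.
by apply/measurable_natb/measurable_fun_ler => //; exact: measurable_norm3.
Qed.

Lemma measurable_cone_density (r P a C : R) :
  measurable_fun setT (cone_density r P a C).
Proof.
rewrite (_ : cone_density r P a C = fun z =>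
  C * (norm3 z.2 <= r)%R%:R * cone_indicator P a z)%R; last first.
  by apply/funext => z; rewrite cone_densityE.
apply: measurable_funM; last exact: measurable_cone_indicator.
apply: measurable_funM => //.
exact: (measurableT_comp (measurable_ball_indicator r) measurable_snd).
Qed.

Lemma cone_density_ge0 (r P a C : R) z : (0 <= C)%R ->
  (0 <= cone_density r P a C z)%R.
Proof. by move=> C0; rewrite cone_densityE !mulr_ge0. Qed.

(** The origin is null, being the ball of radius 0. It has to be left out because at q = 0 the
    cosine is 0 by convention, and the momentum slice there differs from all the others. *)
Lemma eq_integral_neq0 (h k : vec3 R -> \bar R) :
  measurable_fun setT h -> measurable_fun setT k ->
  (forall q, 0 <= h q) -> (forall q, 0 <= k q) ->
  (forall q, q != 0%R -> h q = k q) ->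
  \int[leb3 R]_q h q = \int[leb3 R]_q k q.
Proof.
move=> mh mk h0 k0 hk; apply: ge0_ae_eq_integral => //.
pose O : set (vec3 R) := [set q | (norm3 q <= 0)%R].
have mO : measurable O.
  have mb : measurable_fun setT (fun q : vec3 R => norm3 q <= 0)%R.
    by apply: measurable_fun_ler => //; exact: measurable_norm3.
  by have := mb measurableT [set true] I; rewrite setTI.
exists O; split => //.
- rewrite -(setIT O) -[LHS](integral_indic (leb3 R) measurableT mO).
  rewrite -[RHS](_ : (4 / 3 * @unit_disk_area R * 0 ^+ 3)%:E = 0)%R.
    rewrite -integral_ball//; apply: eq_integral => q _; rewrite indicE.
    by congr ((nat_of_bool _)%:R%:E)%R; apply/idP/idP; rewrite inE.
  by rewrite expr0n mulr0.
- move=> q /= hkq; rewrite /O/=; have [//|q0] := boolP (norm3 q <= 0)%R.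
  exfalso; apply: hkq => _; apply: hk.
  by apply: contra q0 => /eqP ->; rewrite le_eqVlt norm3_eq0 eqxx.
Qed.

(** The momentum integral has the same value [A] over every q other than 0, so the phase-space
    integral factorises. This is the independence of |p| and |q|; [alpha] will be 1 or the
    identity. *)
Lemma integral_cone_density (r P a C A : R) (alpha : R -> R)
    (B : vec3 R -> \bar R) :
  (0 <= C)%R -> (0 <= A)%R ->
  measurable_fun setT (alpha : measurableTypeR R -> R) ->
  (forall s, 0 <= s -> 0 <= alpha s)%R ->
  measurable_fun setT B -> (forall q, 0 <= B q) ->
  (forall u, u != 0%R ->
    \int[leb3 R]_p (cone_indicator P a (p, u) * alpha (norm3 p))%:E = A%:E) ->
  \int[leb6 R]_z (B z.2 * (cone_density r P a C z * alpha (norm3 z.1))%:E) =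
  (C * A)%:E * \int[leb3 R]_q (B q * ((norm3 q <= r)%R%:R)%:E).
Proof.
move=> C0 A0 malpha alpha0 mB B0 intA.
pose F (z : phase R) := B z.2 * (cone_density r P a C z * alpha (norm3 z.1))%:E.
have mF : measurable_fun setT F.
  apply: emeasurable_funM; first exact: measurableT_comp.
  apply/measurable_EFinP; apply: measurable_funM.
    exact: measurable_cone_density.
  by apply: (measurableT_comp malpha); exact: measurable_norm3.
have F0 z : 0 <= F z.
  apply: mule_ge0 => //; rewrite lee_fin mulr_ge0 ?cone_density_ge0//.
  by rewrite alpha0// norm3_ge0.
have mBr : measurable_fun setT (fun q => B q * ((norm3 q <= r)%R%:R)%:E).
  apply: emeasurable_funM => //; apply/measurable_EFinP.
  exact: measurable_ball_indicator.
have Br0 q : 0 <= B q * ((norm3 q <= r)%R%:R)%:E by rewrite mule_ge0.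
rewrite [LHS](sf_product_integral2 (leb3 R) (leb3 R) mF F0).
rewrite -ge0_integralZl_EFin//; last by rewrite mulr_ge0.
apply: eq_integral_neq0.
- exact: (measurable_fun_fubini_tonelli_G (m1 := leb3 R) F mF F0).
- by apply: emeasurable_funM.
- by move=> q; exact: integral_ge0.
- by move=> q; rewrite mule_ge0// lee_fin mulr_ge0.
move=> q q0.
transitivity (\int[leb3 R]_p (B q * (C * (norm3 q <= r)%R%:R)%:E *
    (cone_indicator P a (p, q) * alpha (norm3 p))%:E)).
  apply: eq_integral => p _; rewrite /F cone_densityE/= -muleA -EFinM;
    congr (_ * _%:E); ring.
rewrite ge0_integralZl//.
- rewrite intA// -muleA -EFinM muleCA -EFinM.
  by congr (_ * _%:E); ring.
- apply/measurable_EFinP/measurable_funM.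
    apply: (measurableT_comp (g := fun p => (p, q))
      (measurable_cone_indicator P a)).
    exact: measurable_fun_pair.
  by apply: (measurableT_comp malpha); exact: measurable_norm3.
- by move=> p _; rewrite lee_fin !mulr_ge0// alpha0// norm3_ge0.
- by rewrite mule_ge0// lee_fin mulr_ge0.
Qed.

End measurability.

End cone_density.

(** * The self-energy of a uniform ball *)

Section pair_energy.
Local Open Scope ereal_scope.
Context (R : realType).
Notation b3 := (4 / 3 * @unit_disk_area R)%R.

Lemma measurable_inv_dist :
  measurable_fun setT (fun z : vec3 R * vec3 R => (norm3 (z.1 - z.2))^-1 : R)%R.
Proof.
have m1 : measurable_fun setT (fun z : vec3 R * vec3 R => z.1)
  by exact: measurable_fst.
have m2 : measurable_fun setT (fun z : vec3 R * vec3 R => z.2)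
  by exact: measurable_snd.
apply: measurable_invr; under eq_fun do rewrite norm3B.
apply: measurable_sqrt; apply: measurable_funB.
  by apply: measurable_funD; apply: measurable_funX; exact: measurable_norm3.
by apply: measurable_funM => //; exact: measurable_dot3.
Qed.

Lemma measurable_inv_distl (x : vec3 R) :
  measurable_fun setT (fun y : vec3 R => (norm3 (x - y))^-1 : R)%R.
Proof. exact: (measurableT_comp measurable_inv_dist (pair1_measurable x)). Qed.

Lemma integral_ball_norm (r : R) n : (0 <= r)%R ->
  \int[leb3 R]_x ((norm3 x <= r)%R%:R * norm3 x ^+ n.+1)%:E =
  (b3 * 3 / n.+4%:R * r ^+ n.+4)%:E.
Proof.
move=> r0; rewrite -(@moment R _ _ (leb3 R) (cst 1%R) (@norm3 R))//.
- by apply: eq_integral => x _; rewrite mul1r.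
- exact: measurable_norm3.
- by move=> x; exact: norm3_ge0.
- move=> s /andP[s0 _]; rewrite -integral_ball//.
  by apply: eq_integral => x _; rewrite mul1r.
Qed.

(* Splitting the pairs according to which point is farther from the origin
   reduces the self-energy of the ball to surface potentials of balls. *)
Lemma ball_pair_energy_le (r : R) : (0 <= r)%R ->
  \int[leb3 R]_x \int[leb3 R]_y
    ((norm3 x <= r)%R%:R * (norm3 y <= r)%R%:R * (norm3 (x - y))^-1)%:E <=
  (6 / 5 * b3 ^+ 2 * r ^+ 5)%:E.
Proof.
move=> r0.
pose K (z : vec3 R * vec3 R) : R := ((norm3 z.1 <= r)%R%:R *
  ((norm3 z.2 <= norm3 z.1)%R%:R * (norm3 (z.1 - z.2))^-1))%R.
have m1 : measurable_fun setT (fun z : vec3 R * vec3 R => z.1)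
  by exact: measurable_fst.
have m2 : measurable_fun setT (fun z : vec3 R * vec3 R => z.2)
  by exact: measurable_snd.
have mK : measurable_fun setT K.
  apply: measurable_funM.
    exact: (measurableT_comp (measurable_ball_indicator r) m1).
  apply: measurable_funM; last exact: measurable_inv_dist.
  by apply/measurable_natb/measurable_fun_ler; exact: measurable_norm3.
have mK' : measurable_fun setT (fun z => K (z.2, z.1)).
  exact: (measurableT_comp (g := fun z => (z.2, z.1)) mK
    (measurable_fun_pair _ _)).
have K0 z : (0 <= K z)%R by rewrite !mulr_ge0// invr_ge0 norm3_ge0.
have fK0 z : 0 <= (K z)%:E by rewrite lee_fin.
have mE : measurable_fun setT (fun z => (K z)%:E) by exact/measurable_EFinP.
have mE' : measurable_fun setT (fun z => (K (z.2, z.1))%:E)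
  by exact/measurable_EFinP.
(* The inner integral is the surface potential b3 |x|^2, and the second moment of the ball is 3/5 b3
   r^5. The two orderings of a pair together give 6/5. *)
have intK : \int[leb3 R]_x \int[leb3 R]_y (K (x, y))%:E =
    (3 / 5 * b3 ^+ 2 * r ^+ 5)%:E.
  transitivity (\int[leb3 R]_x (b3%:E *
      ((norm3 x <= r)%R%:R * norm3 x ^+ 2)%:E)).
    apply: eq_integral => x _; rewrite /K/=.
    under eq_integral do rewrite EFinM.
    rewrite ge0_integralZl_EFin//; last 2 first.
    - by move=> y _; rewrite lee_fin mulr_ge0// invr_ge0 norm3_ge0.
    - apply/measurable_EFinP; apply: measurable_funM.
        apply/measurable_natb/measurable_fun_ler; last exact: measurable_cst.
        exact: measurable_norm3.
      exact: measurable_inv_distl.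
    by rewrite surface_potential -!EFinM; congr EFin; ring.
  rewrite ge0_integralZl_EFin//.
  - by rewrite integral_ball_norm// -EFinM; congr EFin; field.
  - by move=> x _; rewrite lee_fin mulr_ge0// exprn_ge0// norm3_ge0.
  - apply/measurable_EFinP; apply: measurable_funM.
      exact: measurable_ball_indicator.
    by apply: measurable_funX; exact: measurable_norm3.
  - by rewrite mulr_ge0// unit_disk_area_ge0.
have intK' : \int[leb3 R]_x \int[leb3 R]_y (K (y, x))%:E =
    (3 / 5 * b3 ^+ 2 * r ^+ 5)%:E.
  rewrite -intK; apply/esym.
  by rewrite (fubini_tonelli (m1 := leb3 R) (m2 := leb3 R) (fun z => (K z)%:E)).
apply: (@le_trans _ _ (\int[leb3 R]_x (\int[leb3 R]_y (K (x, y))%:E +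
    \int[leb3 R]_y (K (y, x))%:E))); last first.
  have intK_ge0 x : 0 <= \int[leb3 R]_y (K (x, y))%:E.
    by apply: integral_ge0 => y _; rewrite lee_fin.
  have intK'_ge0 x : 0 <= \int[leb3 R]_y (K (y, x))%:E.
    by apply: integral_ge0 => y _; rewrite lee_fin.
  have mintK := measurable_fun_fubini_tonelli_F (m2 := leb3 R) _ mE.
  have mintK' := measurable_fun_fubini_tonelli_F (m2 := leb3 R) _ mE'.
  rewrite (ge0_integralD _ measurableT (fun x _ => intK_ge0 x) (mintK fK0)
    (fun x _ => intK'_ge0 x) (mintK' (fun=> fK0 _))).
  rewrite intK intK' -EFinD lee_fin le_eqVlt; apply/orP; left.
  by apply/eqP; field.
pose L (z : vec3 R * vec3 R) : R := ((norm3 z.1 <= r)%R%:R *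
  (norm3 z.2 <= r)%R%:R * (norm3 (z.1 - z.2))^-1)%R.
have mL : measurable_fun setT (fun z => (L z)%:E).
  apply/measurable_EFinP; apply: measurable_funM; last exact: measurable_inv_dist.
  apply: measurable_funM.
    exact: (measurableT_comp (measurable_ball_indicator r) m1).
  exact: (measurableT_comp (measurable_ball_indicator r) m2).
have L0 z : 0 <= (L z)%:E.
  by rewrite lee_fin !mulr_ge0// invr_ge0 norm3_ge0.
have mKx x : measurable_fun setT (fun y => (K (x, y))%:E).
  exact: (measurableT_comp mE (pair1_measurable x)).
have mKy x : measurable_fun setT (fun y => (K (y, x))%:E).
  exact: (measurableT_comp mE' (pair1_measurable x)).
apply: ge0_le_integral => //.
- by move=> x _; apply: integral_ge0 => y _; exact: L0 (x, y).
- exact: (measurable_fun_fubini_tonelli_F (m2 := leb3 R) _ mL).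
- apply: emeasurable_funD.
    exact: (measurable_fun_fubini_tonelli_F (m2 := leb3 R) _ mE).
  exact: (measurable_fun_fubini_tonelli_F (m2 := leb3 R) _ mE').
(* Pairs of equal norm are counted twice on the right, hence an inequality rather than an
   equality. *)
move=> x _; rewrite -(ge0_integralD _ measurableT (fun y _ => fK0 (x, y)) (mKx x)
  (fun y _ => fK0 (y, x)) (mKy x)).
apply: ge0_le_integral => //.
- by move=> y _; exact: L0 (x, y).
- exact: (measurableT_comp mL (pair1_measurable x)).
- exact: emeasurable_funD.
move=> y _; rewrite -EFinD lee_fin /K/=.
have [xr|_] := boolP (norm3 x <= r)%R; last first.
  by rewrite !mul0r add0r !mulr_ge0// invr_ge0 norm3_ge0.
have [yr|_] := boolP (norm3 y <= r)%R; last first.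
  by rewrite !(mul0r, mulr0) addr0 !mulr_ge0// invr_ge0 norm3_ge0.
have [yx|xy] := leP (norm3 y) (norm3 x).
  by rewrite !mul1r lerDl mulr_ge0// invr_ge0 norm3_ge0.
have -> : norm3 (x - y)%R = norm3 (y - x)%R.
  by rewrite !norm3B (dot3C x) [(norm3 x ^+ 2 + _)%R]addrC.
by rewrite (ltW xy) !mul1r mul0r add0r.
Qed.

End pair_energy.

(** * Normalisation, energy and virial of the density *)

Section cone_density_integrals.
Local Open Scope ereal_scope.
Context (R : realType) (r P a C : R).
Hypotheses (r0 : (0 < r)%R) (P0 : (0 < P)%R) (C0 : (0 < C)%R).
Notation b3 := (4 / 3 * @unit_disk_area R)%R.
Notation c3 := (unit_cone_volume a).
Notation f := (cone_density r P a C).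

Let c3_ge0 : (0 <= c3)%R.
Proof. by apply: fine_ge0; apply: integral_ge0. Qed.

Let b3_ge0 : (0 <= b3)%R.
Proof. by rewrite mulr_ge0// unit_disk_area_ge0. Qed.

Let f_ge0 z : (0 <= f z)%R.
Proof. by apply: cone_density_ge0; exact: ltW. Qed.

Let mf : measurable_fun setT f.
Proof. exact: measurable_cone_density. Qed.

Let m1 : measurable_fun setT (fun z : phase R => z.1).
Proof. exact: measurable_fst. Qed.

Let m2 : measurable_fun setT (fun z : phase R => z.2).
Proof. exact: measurable_snd. Qed.

Let mn1 : measurable_fun setT (fun z : phase R => norm3 z.1).
Proof. exact: measurable_norm3. Qed.

Let mn2 : measurable_fun setT (fun z : phase R => norm3 z.2).
Proof. exact: measurable_norm3. Qed.

Lemma cone_moment0 u : u != 0%R ->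
  \int[leb3 R]_p (cone_indicator P a (p, u))%:E = (c3 * P ^+ 3)%:E.
Proof.
move=> u0; rewrite -(integral_cone _ (ltW P0) u0).
by apply: eq_integral => p _; rewrite /cone_indicator mulrC.
Qed.

Lemma cone_moment1 u : u != 0%R ->
  \int[leb3 R]_p (cone_indicator P a (p, u) * norm3 p)%:E =
  (c3 * 3 / 4 * P ^+ 4)%:E.
Proof.
move=> u0.
pose w (p : vec3 R) : R := (dot3 p u / (norm3 p * norm3 u) <= a)%R%:R.
have mw : measurable_fun setT w.
  apply/measurable_natb/measurable_fun_ler => //; apply: measurable_funM.
    exact: measurable_dot3.
  apply: measurable_invr; apply: measurable_funM => //.
  exact: measurable_norm3.
rewrite -(@moment R _ _ (leb3 R) w (@norm3 R) c3 P)//.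
- exact: measurable_norm3.
- by move=> p; exact: norm3_ge0.
- exact: ltW.
- move=> s /andP[s0 _]; rewrite -(integral_cone _ s0 u0).
  by apply: eq_integral => p _; rewrite mulrC.
Qed.

(** The constant value of the spatial marginal in the ball of radius r, away from the centre. *)
Let kappa : R := (C * (c3 * P ^+ 3))%R.

Let kappa_ge0 : (0 <= kappa)%R.
Proof. by rewrite !mulr_ge0// ?exprn_ge0// ltW. Qed.

Lemma spatial_integral (B : vec3 R -> \bar R) :
  measurable_fun setT B -> (forall q, 0 <= B q) ->
  \int[leb6 R]_z (B z.2 * (f z)%:E) =
  kappa%:E * \int[leb3 R]_q (B q * ((norm3 q <= r)%R%:R)%:E).
Proof.
move=> mB B0.
rewrite -(@integral_cone_density R r P a C _ (cst 1%R) B)//; last 3 first.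
- exact: ltW.
- by rewrite mulr_ge0// exprn_ge0// ltW.
- move=> u u0; rewrite -(cone_moment0 u0).
  by apply: eq_integral => p _; rewrite mulr1.
by apply: eq_integral => z _; rewrite mulr1.
Qed.

Lemma cone_density_mass : mass f = (kappa * (b3 * r ^+ 3))%:E.
Proof.
rewrite /mass; transitivity (\int[leb6 R]_z (cst 1 z.2 * (f z)%:E)).
  by apply: eq_integral => z _; rewrite mul1e.
rewrite (spatial_integral (B := cst 1))//.
rewrite [RHS]EFinM -(integral_ball (ltW r0)); congr (_ * _).
by apply: eq_integral => z _; rewrite mul1e.
Qed.

Hypothesis mass1 : mass f = 1.

Let kb : (kappa * (b3 * r ^+ 3) = 1)%R.
Proof. by have := mass1; rewrite cone_density_mass => -[]. Qed.

Let moment1_ge0 : (0 <= c3 * 3 / 4 * P ^+ 4)%R.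
Proof.
apply: mulr_ge0; first by rewrite divr_ge0// mulr_ge0.
exact/exprn_ge0/ltW.
Qed.

Lemma integral_momentum_norm :
  \int[leb6 R]_z (f z * norm3 z.1)%:E = (3 / 4 * P)%:E.
Proof.
transitivity (\int[leb6 R]_z (cst 1 z.2 * (f z * norm3 z.1)%:E)).
  by apply: eq_integral => z _; rewrite mul1e.
rewrite (@integral_cone_density R r P a C (c3 * 3 / 4 * P ^+ 4) id (cst 1))//.
- rewrite (_ : \int[leb3 R]_q _ = (b3 * r ^+ 3)%:E); last first.
    rewrite -(integral_ball (ltW r0)).
    by apply: eq_integral => z _; rewrite mul1e.
  rewrite -EFinM; congr EFin.
  transitivity (3 / 4 * P * (kappa * (b3 * r ^+ 3)))%R; last by rewrite kb mulr1.
  by rewrite /kappa; field.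
- exact: ltW.
- by move=> u; exact: cone_moment1.
Qed.

Lemma integral_norms :
  \int[leb6 R]_z (norm3 z.2 * norm3 z.1 * f z)%:E = (9 / 16 * r * P)%:E.
Proof.
transitivity (\int[leb6 R]_z ((norm3 z.2)%:E * (f z * norm3 z.1)%:E)).
  by apply: eq_integral => z _; rewrite -EFinM; congr EFin; ring.
rewrite (@integral_cone_density R r P a C (c3 * 3 / 4 * P ^+ 4) id
  (fun q => (norm3 q)%:E))//.
- rewrite (_ : \int[leb3 R]_q _ = (b3 * 3 / 4 * r ^+ 4)%:E); last first.
    rewrite -(integral_ball_norm 0 (ltW r0)).
    by apply: eq_integral => z _; rewrite -EFinM mulrC.
  rewrite -EFinM; congr EFin.
  transitivity (9 / 16 * r * P * (kappa * (b3 * r ^+ 3)))%R; last first.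
    by rewrite kb mulr1.
  by rewrite /kappa; field.
- exact: ltW.
- by apply/measurable_EFinP; exact: measurable_norm3.
- by move=> q; rewrite lee_fin norm3_ge0.
- by move=> u; exact: cone_moment1.
Qed.

Lemma virial_ge : (- (9 / 16 * r * P))%:E <= virial f.
Proof.
have mg : measurable_fun setT (fun z => (dot3 z.2 z.1 * f z)%:E).
  by apply/measurable_EFinP/measurable_funM => //; exact: measurable_dot3.
have : `|virial f| <= (9 / 16 * r * P)%:E.
  apply: (le_trans (le_abse_integral (leb6 R) measurableT mg)).
  rewrite -integral_norms; apply: ge0_le_integral => //.
  - exact: measurableT_comp.
  - by apply/measurable_EFinP/measurable_funM => //; exact: measurable_funM.
  - move=> z _; rewrite lee_fin normrM (ger0_norm (f_ge0 z)).
    by apply: ler_wpM2r => //; exact: dot3_norm_le.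
(* The bound on the absolute value also rules out an infinite virial. *)
case: (virial f) => [v| |] //.
by rewrite !lee_fin ler_norml => /andP[].
Qed.

(** The kernel depends on positions only, so each phase-space integral reduces to one over the ball
    with weight kappa. This leaves kappa^2 times the self-energy 6/5 b3^2 r^5 of the ball, and kappa
    b3 r^3 = 1 turns the product into 6/(5r). *)
Lemma pair_energy_le :
  \int[leb6 R \x leb6 R]_w
    (f w.2 * f w.1 / norm3 (w.1.2 - w.2.2))%:E <= (6 / 5 / r)%:E.
Proof.
pose I (q : vec3 R) : \bar R :=
  \int[leb3 R]_y ((norm3 y <= r)%R%:R * (norm3 (q - y))^-1)%:E.
have mD : measurable_fun setT (fun z : vec3 R * vec3 R =>
    ((norm3 z.2 <= r)%R%:R * (norm3 (z.1 - z.2))^-1)%:E).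
  apply/measurable_EFinP/measurable_funM; last exact: measurable_inv_dist.
  exact: (measurableT_comp (measurable_ball_indicator r) measurable_snd).
have D0 (z : vec3 R * vec3 R) :
    0 <= ((norm3 z.2 <= r)%R%:R * (norm3 (z.1 - z.2))^-1)%:E.
  by rewrite lee_fin mulr_ge0// invr_ge0 norm3_ge0.
have mI : measurable_fun setT I.
  exact: (measurable_fun_fubini_tonelli_F (m2 := leb3 R) _ mD D0).
have I0 q : 0 <= I q by apply: integral_ge0 => y _; exact: D0 (q, y).
have mDx x : measurable_fun setT (fun y =>
    ((norm3 y <= r)%R%:R * (norm3 (x - y))^-1)%:E).
  exact: (measurableT_comp mD (pair1_measurable x)).
have mfw1 : measurable_fun setT (fun w : phase R * phase R => f w.1).
  exact: (measurableT_comp mf measurable_fst).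
have mfw2 : measurable_fun setT (fun w : phase R * phase R => f w.2).
  exact: (measurableT_comp mf measurable_snd).
have mpos : measurable_fun setT
    (fun w : phase R * phase R => (w.1.2, w.2.2) : vec3 R * vec3 R).
  by apply: measurable_fun_pair; [exact: (measurableT_comp m2 measurable_fst)|
    exact: (measurableT_comp m2 measurable_snd)].
rewrite fubini_tonelli1; last 2 first.
- apply/measurable_EFinP/measurable_funM; first exact: measurable_funM.
  exact: (measurableT_comp (@measurable_inv_dist R) mpos).
- by move=> w; rewrite lee_fin divr_ge0 ?norm3_ge0// mulr_ge0.
have inner (z : phase R) : \int[leb6 R]_y (f y * f z / norm3 (z.2 - y.2))%:E =
    kappa%:E * I z.2 * (f z)%:E.
  transitivity (\int[leb6 R]_y ((f z / norm3 (z.2 - y.2))%:E * (f y)%:E)).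
    by apply: eq_integral => y _; rewrite -EFinM; congr EFin; ring.
  have md : measurable_fun setT (fun q : vec3 R => (norm3 (z.2 - q))^-1 : R)%R.
    exact: measurable_inv_distl.
  rewrite (spatial_integral (B := fun q : vec3 R => (f z / norm3 (z.2 - q))%:E)).
  - rewrite -muleA; congr (_ * _); rewrite muleC /I -ge0_integralZl_EFin//.
    + by apply: eq_integral => q _; rewrite -!EFinM; congr EFin; ring.
    + by move=> y _; exact: D0 (z.2, y).
  - by apply/measurable_EFinP/measurable_funM.
  - by move=> q; rewrite lee_fin divr_ge0// norm3_ge0.
rewrite /fubini_F; under eq_integral do rewrite inner.
rewrite (spatial_integral (B := fun q => kappa%:E * I q)); last 2 first.
- by apply: measurable_funeM.
- by move=> q; rewrite mule_ge0.
apply: (@le_trans _ _ (kappa%:E * (kappa%:E * \int[leb3 R]_x \int[leb3 R]_y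
    ((norm3 x <= r)%R%:R * (norm3 y <= r)%R%:R * (norm3 (x - y))^-1)%:E))).
  rewrite le_eqVlt; apply/orP; left; apply/eqP; congr (_ * _).
  under eq_integral do rewrite -muleA.
  rewrite ge0_integralZl_EFin//.
  - congr (_ * _); apply: eq_integral => x _; rewrite muleC /I.
    rewrite -ge0_integralZl_EFin//.
    + by apply: eq_integral => y _; rewrite -EFinM mulrA.
    + by move=> y _; exact: D0 (x, y).
  - by move=> x _; rewrite mule_ge0.
  - apply: emeasurable_funM => //; apply/measurable_EFinP.
    exact: measurable_ball_indicator.
rewrite muleA -EFinM.
apply: (le_trans (lee_wpmul2l _ (ball_pair_energy_le (ltW r0)))).
  by rewrite lee_fin mulr_ge0.
rewrite -EFinM lee_fin le_eqVlt; apply/orP; left; apply/eqP.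
transitivity (6 / 5 / r * (kappa * (b3 * r ^+ 3)) ^+ 2)%R.
  by field; rewrite gt_eqF.
by rewrite kb expr1n mulr1.
Qed.

(* On the support, sqrt (1 + |p|^2) >= |p| + delta; this gap is what makes the
   final inequality strict. *)
Let delta : R := (2 * (1 + P))^-1%R.

Let delta_gt0 : (0 < delta)%R.
Proof. by rewrite invr_gt0 mulr_gt0// addr_gt0. Qed.

Lemma kinetic_energy_ge :
  (3 / 4 * P + delta)%:E <=
  \int[leb6 R]_z (Num.sqrt (1 + norm3 z.1 ^+ 2) * f z)%:E.
Proof.
have -> : (3 / 4 * P + delta)%:E =
    \int[leb6 R]_z ((norm3 z.1 + delta) * f z)%:E.
  rewrite EFinD -integral_momentum_norm -[delta%:E]mule1 -mass1 /mass.
  rewrite -ge0_integralZl_EFin ?ltW//; last 2 first.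
  - by move=> z _; rewrite lee_fin.
  - exact/measurable_EFinP.
  rewrite -ge0_integralD//.
  - by apply: eq_integral => z _; rewrite -EFinM -EFinD; congr EFin; ring.
  - by move=> z _; rewrite lee_fin mulr_ge0// norm3_ge0.
  - exact/measurable_EFinP/measurable_funM.
  - by move=> z _; rewrite lee_fin mulr_ge0// ltW.
  - exact/measurable_EFinP/measurable_funM.
apply: ge0_le_integral => //.
- by move=> z _; rewrite lee_fin mulr_ge0// addr_ge0// ?norm3_ge0// ltW.
- by apply/measurable_EFinP/measurable_funM => //; exact: measurable_funD.
- apply/measurable_EFinP/measurable_funM => //; apply: measurable_sqrt.
  by apply: measurable_funD => //; exact: measurable_funX.
move=> z _; rewrite lee_fin cone_densityE /cone_indicator.
have [zP|_] := boolP (norm3 z.1 <= P)%R; last by rewrite !mulr0.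
apply: ler_wpM2r; first by rewrite !mulr_ge0// ltW.
have n0 := norm3_ge0 z.1.
have nd0 : (0 <= norm3 z.1 + delta)%R by rewrite addr_ge0// ltW.
rewrite -(ger0_norm nd0) -sqrtr_sqr; apply: ler_wsqrtr.
(* After squaring, the claim is 2 delta |p| + delta^2 <= 1. The choice of delta gives 2 delta P = 1
   - 2 delta, and delta^2 <= delta absorbs the square. *)
have dP : (delta * (2 * (1 + P)) = 1)%R.
  by rewrite mulVf// gt_eqF// mulr_gt0// addr_gt0.
have d1 : (delta <= 1)%R by rewrite -dP ler_peMr ?ltW//; lra.
have : (delta * norm3 z.1 <= delta * P)%R by rewrite ler_wpM2l// ltW.
have : (delta * delta <= delta * 1)%R by rewrite ler_wpM2l// ltW.
by nra.
Qed.

Hypothesis energy0 : energy f = 0.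

Lemma virial_gt : (- (9 / 20))%:E < virial f.
Proof.
have KE := kinetic_energy_ge; have PE := pair_energy_le.
apply: lt_le_trans virial_ge; rewrite lte_fin ltrN2.
suff : (3 / 4 * P + delta <= 3 / 5 / r)%R.
  rewrite ler_pdivlMr// => Pr.
  have := mulr_gt0 delta_gt0 r0; nra.
move: energy0; rewrite /energy.
have : 0 <= \int[leb6 R \x leb6 R]_w
    (f w.2 * f w.1 / norm3 (w.1.2 - w.2.2))%:E.
  by apply: integral_ge0 => w _; rewrite lee_fin divr_ge0 ?norm3_ge0// mulr_ge0.
move: KE PE.
(* The bounds confine the pair energy to a real [i]; an infinite kinetic energy would then make the
   total energy infinite. Zero energy becomes the real equation k = i/2. *)
case: (integral _ _ _) => [k| |] //; case: (integral _ _ _) => [i| |] //.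
- rewrite !lee_fin => Kk Ii _ [] ki; apply: (le_trans Kk).
  have -> : k = (2^-1 * i)%R by apply/eqP; rewrite -subr_eq0 ki.
  by have -> : (3 / 5 / r = 2^-1 * (6 / 5 / r))%R; [field; rewrite gt_eqF|
    rewrite ler_wpM2l// invr_ge0].
Qed.

End cone_density_integrals.

Theorem mainTheorem4 (R : realType) (r P a C : R)
  (r_gt0 : 0 < r) (P_gt0 : 0 < P) (a_gtN1 : -1 < a) (a_lt1 : a < 1)
  (C_gt0 : 0 < C)
  (normalized : mass (cone_density r P a C) = 1%E)
  (energy_eq0 : energy (cone_density r P a C) = 0%E) :
  ((- (9 / 20))%:E < virial (cone_density r P a C))%E.
Proof. exact: virial_gt. Qed.
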